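(* Let $A\in\mathbb{R}^{m\times n}$, $b,z\in\mathbb{R}^m$, $\bar x\in\mathbb{R}^n$, $\gamma,\delta',\lambda_{\mathrm{tgt}},\tilde s,\gamma_{\mathrm{inc}},\gamma_{\mathrm{dec}},L_{\min}$ satisfy the Standing Assumption given in the context, with $\lambda_{\mathrm{tgt}}\le\lambda_0=\|A^Tb\|_\infty$. Let $\epsilon>0$ and let the parameters $\delta,\eta\in(0,1)$ of Algorithm Homotopy (see context) be such that $$\frac{1+\delta}{1+\delta'}\le\eta<1.$$ Let $N=\lfloor\ln(\lambda_0/\lambda_{\mathrm{tgt}})/\ln\eta^{-1}\rfloor$ as in the algorithm, $\kappa=\rho_+(A,\bar s+2\tilde s)/\rho_-(A,\bar s+2\tilde s)$, and $C=8\gamma_{\mathrm{inc}}(1+\kappa)^2(1+\gamma)\kappa\bar s$. Then: 1. In each call of Algorithm ProxGrad made by Algorithm Homotopy, with regularization parameter $\lambda$ and initial point $x^{(0)}$ of that call, one has $\|x^{(0)}_{\bar S^c}\|_0\le\tilde s$ and $\omega_\lambda(x^{(0)})\le\delta'\lambda$. For $K=0,\dots,N-1$, the number of proximal-gradient steps in the corresponding call of ProxGrad (the one with regularization parameter $\lambda_{K+1}$) is no more than $$\ln\Big(\frac{C}{\delta^2}\Big)\Big/\ln\Big(1-\frac{1}{4\gamma_{\mathrm{inc}}\kappa}\Big)^{-1}.$$ 2. For $K=0,\dots,N-1$, the outer-loop iterates $\hat x^{(K)}$ satisfy $$\phi_{\lambda_{\mathrm{tgt}}}(\hat x^{(K)})-\phi^\star_{\lambda_{\mathrm{tgt}}}\le\eta^{2(K+1)}\,\frac{4.5(1+\gamma)\lambda_0^2\bar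 s}{\rho_-(A,\bar s+\tilde s)} \quad\text{and}\quad \|\hat x^{(K)}-\bar x\|_2\le\eta^{K+1}\,\frac{2\lambda_0\sqrt{\bar s}}{\rho_-(A,\bar s+\tilde s)}.$$ 3. When Algorithm Homotopy terminates, the total number of proximal-gradient steps is no more than $$\left(\frac{\ln(\lambda_0/\lambda_{\mathrm{tgt}})}{\ln\eta^{-1}}\ln\Big(\frac{C}{\delta^2}\Big)+\ln\max\Big(1,\frac{\lambda_{\mathrm{tgt}}^2C}{\epsilon^2}\Big)\right)\Big/\ln\Big(1-\frac{1}{4\gamma_{\mathrm{inc}}\kappa}\Big)^{-1},$$ and the output $\hat x^{(\mathrm{tgt})}$ satisfies $$\phi_{\lambda_{\mathrm{tgt}}}(\hat x^{(\mathrm{tgt})})-\phi^\star_{\lambda_{\mathrm{tgt}}}\le\frac{4(1+\gamma)\lambda_{\mathrm{tgt}}\bar s}{\rho_-(A,\bar s+\tilde s)}\,\epsilon.$$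
   Context: Notation. $f(x)=\frac12\|Ax-b\|_2^2$, so $\nabla f(x)=A^T(Ax-b)$; $\phi_\lambda(x)=f(x)+\lambda\|x\|_1$; $\phi_\lambda^\star=\min_x\phi_\lambda(x)$. The optimality residue is $\omega_\lambda(x)=\min_{\xi\in\partial\|x\|_1}\|\nabla f(x)+\lambda\xi\|_\infty$, where $\partial\|x\|_1$ is the subdifferential of the $\ell_1$ norm at $x$. $\|x\|_0$ is the number of nonzero entries of $x$; $\mathrm{supp}(x)=\{j:x_j\ne0\}$; $x_{S}$ is the restriction of $x$ to coordinates in $S$; $S^c$ is the complement of $S$ in $\{1,\dots,n\}$. Restricted eigenvalues. For an integer $s>0$, $\rho_+(A,s)=\sup\{x^TA^TAx/x^Tx: x\ne0,\|x\|_0\le s\}$ and $\rho_-(A,s)=\inf\{x^TA^TAx/x^Tx: x\ne0,\|x\|_0\le s\}$. Standing Assumption. $b=A\bar x+z$, $\bar S=\mathrm{supp}(\bar x)$, $\bar s=|\bar S|$; $\gamma_{\mathrm{inc}}>1$, $\gamma_{\mathrm{dec}}\ge1$, $\lambda_{\mathrm{tgt}}>0$; $\gamma>0$ and $\delta'\in(0,1)$ satisfy $\gamma>(1+\delta')/(1-\delta')$ and $$\lambda_{\mathrm{tgt}}\ge\max\Big\{4,\frac{\gamma+1}{(1-\delta')\gamma-(1+\delta')}\Big\}\|A^Tz\|_\infty;$$ $\tilde s$ is an integer with $\rho_-(A,\bar s+2\tilde s)>0$ and $$\tilde s>\frac{16\big(\gamma_{\mathrm{inc}}\rho_+(A,\bar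 s+2\tilde s)+2\rho_+(A,\tilde s)\big)}{\rho_-(A,\bar s+\tilde s)}(1+\gamma)\bar s;$$ and $0<L_{\min}\le\gamma_{\mathrm{inc}}\rho_+(A,\bar s+2\tilde s)$. Proximal step. For $L>0$, $\psi_{\lambda,L}(y;x)=f(y)+\nabla f(y)^T(x-y)+\frac L2\|x-y\|_2^2+\lambda\|x\|_1$ and $T_{\lambda,L}(y)=\arg\min_x\psi_{\lambda,L}(y;x)$. Algorithm LineSearch$(\lambda,x,L)$: repeat: set $x^+\leftarrow T_{\lambda,L}(x)$; if $\phi_\lambda(x^+)>\psi_{\lambda,L}(x;x^+)$ then $L\leftarrow L\gamma_{\mathrm{inc}}$; until $\phi_\lambda(x^+)\le\psi_{\lambda,L}(x;x^+)$. Return $\{x^+,M\}$ with $M=L$. Algorithm ProxGrad$(\lambda,\hat\epsilon,x^{(0)},L_0)$, with $\lambda>0$, $\hat\epsilon>0$, $L_0\ge L_{\min}$: for $k=0,1,2,\dots$ compute $\{x^{(k+1)},M_k\}\leftarrow$ LineSearch$(\lambda,x^{(k)},L_k)$ and set $L_{k+1}\leftarrow\max\{L_{\min},M_k/\gamma_{\mathrm{dec}}\}$; stop as soon as $\omega_\lambda(x^{(k+1)})\le\hat\epsilon$ and return $\{\hat x,\hat M\}=\{x^{(k+1)},M_k\}$. A proximal-gradient step is one iteration $x^{(k)}\mapsto x^{(k+1)}$ of ProxGrad. Algorithm Homotopy$(A,b,\lambda_{\mathrm{tgt}},\epsilon,L_{\min})$ with parameters $\eta,\delta\in(0,1)$: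 initialize $\lambda_0\leftarrow\|A^Tb\|_\infty$, $\hat x^{(0)}\leftarrow0$, $\hat M_0\leftarrow L_{\min}$, $N\leftarrow\lfloor\ln(\lambda_0/\lambda_{\mathrm{tgt}})/\ln(1/\eta)\rfloor$. For $K=0,1,\dots,N-1$: $\lambda_{K+1}\leftarrow\eta\lambda_K$, $\hat\epsilon_{K+1}\leftarrow\delta\lambda_{K+1}$, $\{\hat x^{(K+1)},\hat M_{K+1}\}\leftarrow$ ProxGrad$(\lambda_{K+1},\hat\epsilon_{K+1},\hat x^{(K)},\hat M_K)$. Finally $\{\hat x^{(\mathrm{tgt})},\hat M_{\mathrm{tgt}}\}\leftarrow$ ProxGrad$(\lambda_{\mathrm{tgt}},\epsilon,\hat x^{(N)},\hat M_N)$; return $\hat x^{(\mathrm{tgt})}$.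
   Formalization: In item 3 the total number of proximal-gradient steps is bounded by the maximum of 1 and the stated expression: the final ProxGrad call always makes at least one step, while the stated expression can be 0 (N=0 and λ_tgt²C ≤ ε²). *)

(* Defs.v *)
From HB Require Import structures.
From mathcomp Require Export all_boot all_order all_algebra.
From mathcomp Require Export all_classical all_reals all_analysis.

Set Implicit Arguments.
Unset Strict Implicit.
Unset Printing Implicit Defensive.

Import Order.TTheory GRing.Theory Num.Theory.
Import numFieldNormedType.Exports.
Local Open Scope classical_set_scope.
Local Open Scope ring_scope.

(* The l_oo norm of a vector is the library norm `|x| on matrices (the largest
   absolute value of an entry). *)

Definition dot (R : realType) (n : nat) (u v : 'cV[R]_n) : R :=
  \sum_(j < n) u j 0 * v j 0.

Definition norm1 (R : realType) (n : nat) (x : 'cV[R]_n) : R :=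
  \sum_(j < n) `|x j 0|.

Definition norm2 (R : realType) (n : nat) (x : 'cV[R]_n) : R :=
  Num.sqrt (dot x x).

Definition supp (R : realType) (n : nat) (x : 'cV[R]_n) : {set 'I_n} :=
  [set j : 'I_n | x j 0 != 0]%SET.

Definition norm0 (R : realType) (n : nat) (x : 'cV[R]_n) : nat := #|supp x|.

(* Kept in R^n, with zeros outside S. *)
Definition restr (R : realType) (n : nat) (S : {set 'I_n}) (x : 'cV[R]_n) :
    'cV[R]_n :=
  \col_j (if j \in S then x j 0 else 0).

Definition subdiff (R : realType) (n : nat) (g : 'cV[R]_n -> R) (x : 'cV[R]_n) :
    set 'cV[R]_n :=
  [set xi | forall y, g x + dot xi (y - x) <= g y].

Definition argmin (R : realType) (T : Type) (g : T -> R) : set T :=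
  [set x | forall y, g x <= g y].

Section LeastSquares.
Variables (R : realType) (m n : nat) (A : 'M[R]_(m, n)) (b : 'cV[R]_m).
Implicit Types (x y : 'cV[R]_n) (lambda L : R).

Definition lsq x : R := norm2 (A *m x - b) ^+ 2 / 2.

Definition grad_lsq x : 'cV[R]_n := A^T *m (A *m x - b).

Definition phi lambda x : R := lsq x + lambda * norm1 x.

Definition phi_star lambda : R := inf (range (phi lambda)).

Definition omega lambda x : R :=
  inf [set `|grad_lsq x + lambda *: xi| | xi in subdiff (@norm1 R n) x].

Definition psi lambda L y x : R :=
  lsq y + dot (grad_lsq y) (x - y) + L / 2 * norm2 (x - y) ^+ 2
  + lambda * norm1 x.

(* For 0 < L the function psi lambda L y has exactly one minimizer, so the
   default value 0 is never used. *)
Definition prox lambda L y : 'cV[R]_n := xget 0 (argmin (psi lambda L y)).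

(* line_search lambda gamma_inc x L xp M: started at x with the trial value L,
   the search terminates and returns the pair (xp, M). *)
Inductive line_search lambda (gamma_inc : R) x :
    R -> 'cV[R]_n -> R -> Prop :=
| LineSearchStop L :
    phi lambda (prox lambda L x) <= psi lambda L x (prox lambda L x) ->
    line_search lambda gamma_inc x L (prox lambda L x) L
| LineSearchIncr L xp M :
    psi lambda L x (prox lambda L x) < phi lambda (prox lambda L x) ->
    line_search lambda gamma_inc x (L * gamma_inc) xp M ->
    line_search lambda gamma_inc x L xp M.

(* prox_grad lambda eps gamma_inc gamma_dec L_min x L k xh Mh: started at
   (x, L), the method terminates after exactly k proximal-gradient steps (k is
   at least 1, the test being made after each step) and returns (xh, Mh). *)
Inductive prox_grad lambda (eps gamma_inc gamma_dec L_min : R) :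
    'cV[R]_n -> R -> nat -> 'cV[R]_n -> R -> Prop :=
| ProxGradStop x L xp M :
    line_search lambda gamma_inc x L xp M ->
    omega lambda xp <= eps ->
    prox_grad lambda eps gamma_inc gamma_dec L_min x L 1 xp M
| ProxGradNext x L xp M k xh Mh :
    line_search lambda gamma_inc x L xp M ->
    eps < omega lambda xp ->
    prox_grad lambda eps gamma_inc gamma_dec L_min
      xp (Num.max L_min (M / gamma_dec)) k xh Mh ->
    prox_grad lambda eps gamma_inc gamma_dec L_min x L k.+1 xh Mh.

Definition lambda0 : R := `|A^T *m b|.

Definition lambda_ (eta : R) (K : nat) : R := iter K (fun l => eta * l) lambda0.

(* truncn is the floor on nonnegative reals; the argument is nonnegative when
   lambda_tgt <= lambda0. *)
Definition num_stages (eta lambda_tgt : R) : nat :=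
  Num.truncn (ln (lambda0 / lambda_tgt) / ln eta^-1).

End LeastSquares.

(* Everything computed by a terminating execution of the homotopy method: the
   outer iterates (hx K, hM K), the number hsteps K of proximal-gradient steps
   of the call with regularization parameter lambda_(K+1), and the same data
   for the final call. Only the indices K <= N (resp. K < N for hsteps) are
   meaningful. *)
Record homotopy_trace (R : realType) (n : nat) := HomotopyTrace {
  hx : nat -> 'cV[R]_n;
  hM : nat -> R;
  hsteps : nat -> nat;
  hx_tgt : 'cV[R]_n;
  hM_tgt : R;
  hsteps_tgt : nat
}.

Record homotopy_run (R : realType) (m n : nat) (A : 'M[R]_(m, n))
    (b : 'cV[R]_m) (lambda_tgt eps L_min gamma_inc gamma_dec eta delta : R)
    (t : homotopy_trace R n) : Prop := HomotopyRun {
  hrun_x0 : hx t 0 = 0;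
  hrun_M0 : hM t 0 = L_min;
  hrun_stage : forall K : nat, (K < num_stages A b eta lambda_tgt)%N ->
    prox_grad A b (lambda_ A b eta K.+1) (delta * lambda_ A b eta K.+1)
      gamma_inc gamma_dec L_min
      (hx t K) (hM t K) (hsteps t K) (hx t K.+1) (hM t K.+1);
  hrun_final :
    let N := num_stages A b eta lambda_tgt in
    prox_grad A b lambda_tgt eps gamma_inc gamma_dec L_min
      (hx t N) (hM t N) (hsteps_tgt t) (hx_tgt t) (hM_tgt t)
}.

Definition total_steps (R : realType) (n : nat) (t : homotopy_trace R n)
    (N : nat) : nat :=
  ((\sum_(K < N) hsteps t K) + hsteps_tgt t)%N.

Section RestrictedEigenvalues.
Variables (R : realType) (m n : nat) (A : 'M[R]_(m, n)).

Definition sparse_rayleigh (s : nat) : set R :=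
  [set dot x (A^T *m A *m x) / dot x x
     | x in [set x : 'cV[R]_n | x <> 0 /\ (norm0 x <= s)%N]].

Definition rho_plus (s : nat) : R := sup (sparse_rayleigh s).

Definition rho_minus (s : nat) : R := inf (sparse_rayleigh s).

End RestrictedEigenvalues.

(* Main.v *)
Require Import Defs.
From mathcomp Require Import ring lra.

Set Implicit Arguments.
Unset Strict Implicit.
Unset Printing Implicit Defensive.

Import Order.TTheory GRing.Theory Num.Theory.
Import numFieldNormedType.Exports.
Local Open Scope ring_scope.

(** Write [S] for the support of [xbar], [s] for its size, and call a vector
    sparse when it has at most [st] nonzero entries outside [S]. The least-
    squares term need not be strongly convex, but it is so between sparse
    vectors, with constants given by the restricted eigenvalues. The theorem
    holds because the whole run of the method stays among sparse vectors,
    where the proximal-gradient iteration converges linearly.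

    Sparsity is an invariant because the error of an iterate is small.
    Comparing the objective at [x] and at [xbar] bounds the prediction error
    [A (x - xbar)] and the l1 error off [S] by multiples of the scale [lambda
    ^ 2 s / rho] ([err_of_phi_le]); this uses only that the objective at [x]
    hardly exceeds its value at [xbar], a property inherited along a
    decreasing sequence of objective values. A coordinate outside [S] that
    survives the soft thresholding of a proximal step must be fed by one of
    these two errors, and [st] is large enough for their bounds to leave fewer
    than [st] such coordinates ([prox_sparse]). The same argument shows that a
    minimizer over the sparse vectors is fixed by a proximal step, hence is a
    global minimizer ([sparse_minimizer]), so the iteration has a sparse
    target.

    Inside a stage, an accepted step multiplies the gap to the minimum by at
    most [1 - 1 / (gamma_inc kappa)] ([gap_contraction]), and its residue is
    bounded by the gap before the step ([residue_prox_sqr_le]). A stage of [k]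
    steps did not stop at step [k - 1], which bounds [eps ^ 2] by the initial
    gap contracted [k - 2] times ([warm_steps]). The missing powers are
    recovered from two sources of slack: the initial gap is at most half of
    what [C] allows ([warm_gap_le]), and the contraction factor is at most the
    fourth power of the factor [1 - 1 / (4 gamma_inc kappa)] that defines the
    rate ([half_contraction_le], [half_contraction_le_succ]). The count of a
    stage is even one less than claimed; this pays, in the total, for a final
    call that stops at its first step ([run_total_steps]).

    A small residue also confines the error to a cone, where restricted strong
    convexity gives the sharper l1 and l2 error bounds [err_bounds]; by
    convexity the gap is at most the residue times the l1 distance to the
    minimizer ([phi_gap_le_residue]). These give the estimates on the outer
    iterates and on the output. Finally the residue moves by at most the
    change of [lambda], so the ratio [eta] is such that a point of relative
    accuracy [delta] for one parameter has relative accuracy [delta'] for the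
    next ([stage_warm]), which closes the induction over the stages. *)

(** * Scalar products and norms *)

Section Vectors.
Variables (R : realType) (n : nat).
Implicit Types (u v w x y : 'cV[R]_n) (c : R).

Lemma dotC u v : dot u v = dot v u.
Proof. by apply: eq_bigr => j _; rewrite mulrC. Qed.

Lemma dotDr u v w : dot u (v + w) = dot u v + dot u w.
Proof. by rewrite -big_split; apply: eq_bigr => j _; rewrite mxE mulrDr. Qed.

Lemma dotZr c u v : dot u (c *: v) = c * dot u v.
Proof. by rewrite mulr_sumr; apply: eq_bigr => j _; rewrite mxE mulrCA. Qed.

Lemma dotNr u v : dot u (- v) = - dot u v.
Proof. by rewrite -scaleN1r dotZr mulN1r. Qed.

Lemma dotDl u v w : dot (u + v) w = dot u w + dot v w.
Proof. by rewrite !(dotC _ w) dotDr. Qed.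

Lemma dotZl c u v : dot (c *: u) v = c * dot u v.
Proof. by rewrite !(dotC _ v) dotZr. Qed.

Lemma dotNl u v : dot (- u) v = - dot u v.
Proof. by rewrite !(dotC _ v) dotNr. Qed.

Lemma dot0r u : dot u 0 = 0.
Proof. by rewrite -(scale0r 0) dotZr mul0r. Qed.

Lemma dot_delta u (j : 'I_n) : dot (delta_mx j 0) u = u j 0.
Proof.
rewrite /dot (bigD1 j) //= mxE !eqxx mul1r big1 ?addr0 // => i /negPf ij.
by rewrite mxE ij mul0r.
Qed.

Lemma dot_ge0 u : 0 <= dot u u.
Proof. by apply: sumr_ge0 => j _; rewrite -expr2 sqr_ge0. Qed.

Lemma dot_eq0 u : dot u u = 0 -> u = 0.
Proof.
move=> u0; apply/colP => j; rewrite mxE; apply/eqP.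
have /eqP := u0; rewrite /dot psumr_eq0 => [/allP/(_ j)|i _]; last first.
  by rewrite -expr2 sqr_ge0.
by rewrite mem_index_enum -expr2 sqrf_eq0; apply.
Qed.

Lemma norm2_sqr u : norm2 u ^+ 2 = dot u u.
Proof. by rewrite sqr_sqrtr // dot_ge0. Qed.

Lemma Cauchy_Schwarz u v : dot u v ^+ 2 <= dot u u * dot v v.
Proof.
have [v0|v0] := eqVneq (dot v v) 0.
  by rewrite (dot_eq0 v0) !dot0r expr0n /= mulr0.
have vpos : 0 < dot v v by rewrite lt_neqAle eq_sym v0 dot_ge0.
have := dot_ge0 (dot v v *: u - dot u v *: v).
rewrite dotDl !dotDr !dotNl !dotNr !dotZl !dotZr (dotC v u).
set a := dot u u; set c := dot u v; set d := dot v v.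
have -> : d * (d * a) - d * (c * c) + (- (c * (d * c)) - - (c * (c * d)))
  = d * (a * d - c ^+ 2) by ring.
by rewrite pmulr_rge0 // subr_ge0.
Qed.

Lemma entry_sqr_le_dot u (j : 'I_n) : u j 0 ^+ 2 <= dot u u.
Proof.
rewrite /dot (bigD1 j) //= expr2 lerDl sumr_ge0 // => i _.
by rewrite -expr2 sqr_ge0.
Qed.

Lemma entry_le_norm u (j : 'I_n) : `|u j 0| <= `|u|.
Proof.
rewrite -[leRHS]/(mx_norm u) mx_normrE.
by apply/bigmax_geP; right; exists (j, 0).
Qed.

Lemma norm_le u c : 0 <= c -> (forall j, `|u j 0| <= c) -> `|u| <= c.
Proof.
move=> c0 uc; rewrite -[leLHS]/(mx_norm u) mx_normrE.
by apply/bigmax_leP; split=> // -[i j] _ /=; rewrite ord1.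
Qed.

Lemma norm1_ge0 x : 0 <= norm1 x.
Proof. exact: sumr_ge0. Qed.

Lemma norm1D x y : norm1 (x + y) <= norm1 x + norm1 y.
Proof.
by rewrite -big_split; apply: ler_sum => j _; rewrite mxE ler_normD.
Qed.

Lemma norm1Z c x : norm1 (c *: x) = `|c| * norm1 x.
Proof. by rewrite mulr_sumr; apply: eq_bigr => j _; rewrite mxE normrM. Qed.

Lemma norm1N x : norm1 (- x) = norm1 x.
Proof. by rewrite -scaleN1r norm1Z normrN1 mul1r. Qed.

Lemma dot_le_norm1 u v : `|dot u v| <= `|u| * norm1 v.
Proof.
rewrite mulr_sumr; apply: (le_trans (ler_norm_sum _ _ _)).
by apply: ler_sum => j _; rewrite normrM ler_wpM2r // entry_le_norm.
Qed.

(** Cauchy-Schwarz against the signs of [x] on [S]. *)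
Lemma sqr_norm1_on_le (S : {set 'I_n}) x :
  (\sum_(j in S) `|x j 0|) ^+ 2 <= #|S|%:R * dot x x.
Proof.
pose e : 'cV[R]_n := \col_j (if j \in S then Num.sg (x j 0) else 0).
have -> : \sum_(j in S) `|x j 0| = dot e x.
  rewrite big_mkcond; apply: eq_bigr => j _; rewrite mxE.
  by case: ifP => _; rewrite ?mul0r // normrEsg.
apply: le_trans (Cauchy_Schwarz _ _) _; rewrite ler_wpM2r ?dot_ge0 //.
rewrite -sum1_card natr_sum [leRHS]big_mkcond; apply: ler_sum => j _.
rewrite mxE; case: ifP => _; last by rewrite mul0r.
by rewrite -expr2 sqr_sg; case: (_ != 0).
Qed.

End Vectors.

Lemma dot_mulmx (R : realType) (m n : nat) (A : 'M[R]_(m, n)) u v :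
  dot (A *m u) v = dot u (A^T *m v).
Proof.
rewrite /dot.
under eq_bigr => i _ do rewrite mxE mulr_suml.
rewrite exchange_big /=; apply: eq_bigr => j _; rewrite mxE mulr_sumr.
by apply: eq_bigr => i _; rewrite mxE mulrAC mulrC mulrA.
Qed.

(** * Subgradients of the l1 norm and the optimality residue *)

Section Subdifferential.
Variables (R : realType) (n : nat).
Implicit Types (x y xi g : 'cV[R]_n) (lambda : R).

Lemma subdiff_norm1P x xi :
  subdiff (@norm1 R n) x xi <->
  forall j, `|xi j 0| <= 1 /\ xi j 0 * x j 0 = `|x j 0|.
Proof.
split=> [sub j|sub y]; last first.
  rewrite /norm1 /dot -big_split; apply: ler_sum => j _ /=.
  have [xi1 xix] := sub j; rewrite !mxE mulrBr xix addrC subrK.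
  apply: le_trans (ler_norm _) _; rewrite normrM.
  by rewrite -[leRHS]mul1r ler_wpM2r.
(* Moving the single coordinate j by t turns the subgradient inequality into
   its one-dimensional instance. *)
have sub1 t : `|x j 0| + t * xi j 0 <= `|x j 0 + t|.
  have := sub (x + t *: delta_mx j 0).
  rewrite addrAC subrr add0r dotZr dotC dot_delta /norm1.
  rewrite (bigD1 j) //= [leRHS](bigD1 j) //= !mxE !eqxx mulr1.
  rewrite [X in _ <= _ + X](eq_bigr (fun i => `|x i 0|)); last first.
    by move=> i /negPf ij; rewrite !mxE ij mulr0 addr0.
  by rewrite addrAC lerD2r.
have xi1 : `|xi j 0| <= 1.
  rewrite ler_norml; apply/andP; split.
    have := sub1 (-1); have := ler_normD (x j 0) (-1); rewrite normrN1; lra.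
  have := sub1 1; have := ler_normD (x j 0) 1; rewrite normr1; lra.
split=> //; apply/eqP; rewrite eq_le; apply/andP; split.
  apply: le_trans (ler_norm _) _; rewrite normrM.
  by rewrite -[leRHS]mul1r ler_wpM2r.
by have := sub1 (- x j 0); rewrite subrr normr0; lra.
Qed.

(** The residue is attained: coordinatewise, the best subgradient is forced
    where [x] is nonzero and otherwise projects [- g / lambda] on [-1, 1]. *)
Lemma subgradient_minimizing_residue x g lambda : 0 < lambda ->
  exists2 xi, subdiff (@norm1 R n) x xi &
  forall xi', subdiff (@norm1 R n) x xi' ->
    `|g + lambda *: xi| <= `|g + lambda *: xi'|.
Proof.
move=> l0.
pose clamp t : R := if t <= -1 then -1 else if 1 <= t then 1 else t.
pose xi : 'cV[R]_n := \col_j (if x j 0 == 0 then clamp (- g j 0 / lambda)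
                              else Num.sg (x j 0)).
exists xi.
  apply/subdiff_norm1P => j; rewrite mxE; case: eqP => [->|/eqP xj].
    rewrite mulr0 normr0; split=> //; rewrite /clamp.
    case: (leP _ (-1)) => [_|?]; first by rewrite normrN1.
    by case: (leP 1 (_ / _)) => [_|?]; rewrite ?normr1 // ler_norml !ltW.
  by rewrite normr_sg xj -normrEsg.
move=> xi' /subdiff_norm1P sub; apply: norm_le => // j.
apply: le_trans (entry_le_norm _ j); rewrite !mxE.
have [xi'1 xi'x] := sub j.
case: eqP => [xj|/eqP xj].
  set t := - g j 0 / lambda.
  have -> : g j 0 = lambda * (- t) by rewrite /t; field; lra.
  rewrite -!mulrDr !normrM ler_wpM2l //.
  move: xi'1; rewrite ler_norml => /andP[lo hi]; rewrite /clamp.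
  case: (leP t (-1)) => h1.
    rewrite !ger0_norm; lra.
  case: (leP 1 t) => h2.
    rewrite !ler0_norm; lra.
  by rewrite addNr normr0.
suff -> : xi' j 0 = Num.sg (x j 0) by [].
apply: (mulIf xj); rewrite xi'x; exact: normrEsg.
Qed.

End Subdifferential.

Section CompositeObjective.
Variables (R : realType) (m n : nat) (A : 'M[R]_(m, n)) (b : 'cV[R]_m).
Implicit Types (x y p xi : 'cV[R]_n) (lambda L : R).

Definition energy x : R := dot (A *m x) (A *m x).

Lemma energy_ge0 x : 0 <= energy x.
Proof. exact: dot_ge0. Qed.


Lemma lsqE x y :
  lsq A b y = lsq A b x + dot (grad_lsq A b x) (y - x) + energy (y - x) / 2.
Proof.
have -> : dot (grad_lsq A b x) (y - x) = dot (A *m x - b) (A *m (y - x)).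
  by rewrite dotC -dot_mulmx dotC.
rewrite /lsq !norm2_sqr /energy.
have -> : A *m y - b = (A *m x - b) + A *m (y - x).
  by rewrite mulmxBr [RHS]addrC addrA subrK.
move: (A *m x - b) (A *m (y - x)) => u v.
by rewrite dotDl !dotDr (dotC v u); field.
Qed.

Lemma residue_le_norm lambda x xi : subdiff (@norm1 R n) x xi ->
  omega A b lambda x <= `|grad_lsq A b x + lambda *: xi|.
Proof.
move=> sub; apply: ge_inf; last by exists xi.
by exists 0 => _ [xi' _ <-].
Qed.

Lemma residue_attained lambda x : 0 < lambda ->
  exists2 xi, subdiff (@norm1 R n) x xi &
    omega A b lambda x = `|grad_lsq A b x + lambda *: xi|.
Proof.
move=> /(subgradient_minimizing_residue x (grad_lsq A b x))[xi sub min].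
exists xi => //; apply/eqP; rewrite eq_le residue_le_norm //=.
apply: lb_le_inf => [|_ [xi' /min ? <-] //].
by exists `|grad_lsq A b x + lambda *: xi|, xi.
Qed.

Lemma residue_ge0 lambda x : 0 < lambda -> 0 <= omega A b lambda x.
Proof. by move=> /(residue_attained x)[xi _ ->]. Qed.

Lemma residue_decrease_lambda lambda lambda' x : 0 < lambda' <= lambda ->
  omega A b lambda' x <= omega A b lambda x + (lambda - lambda').
Proof.
case/andP=> l'0 l'l.
have [|xi sub ->] := residue_attained (lambda := lambda) x; first lra.
apply: le_trans (residue_le_norm _ sub) _.
have -> : grad_lsq A b x + lambda' *: xi =
  (grad_lsq A b x + lambda *: xi) + (lambda' - lambda) *: xi.
  by rewrite -addrA -scalerDl [lambda + _]addrC subrK.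
apply: le_trans (ler_normD _ _) _; rewrite lerD2l.
apply: norm_le => [|j]; first lra.
have /subdiff_norm1P/(_ j)[xi1 _] := sub.
rewrite mxE normrM distrC [`|lambda - _|]ger0_norm ?subr_ge0 // -[leRHS]mulr1.
by rewrite ler_wpM2l // subr_ge0.
Qed.

(** Convexity: the optimality residue bounds the decrease of the objective
    towards any other point. *)
Lemma phi_gap_le_residue lambda x y : 0 < lambda ->
  phi A b lambda x - phi A b lambda y <= omega A b lambda x * norm1 (x - y).
Proof.
move=> l0; have [xi sub ->] := residue_attained x l0.
rewrite -(norm1N (x - y)) opprB.
apply: le_trans (dot_le_norm1 _ _); rewrite ler_normr; apply/orP; right.
have := sub y; rewrite -(ler_pM2l l0) mulrDr => suby.
rewrite dotDl dotZl /phi (lsqE x y).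
have := energy_ge0 (y - x); lra.
Qed.

Lemma phi_ge_norm1 lambda x : lambda * norm1 x <= phi A b lambda x.
Proof. by rewrite lerDr /lsq divr_ge0 // sqr_ge0. Qed.

Lemma phi_starE lambda xs : (forall y, phi A b lambda xs <= phi A b lambda y) ->
  phi_star A b lambda = phi A b lambda xs.
Proof.
move=> min; apply/eqP; rewrite eq_le; apply/andP; split.
  by apply: ge_inf; [exists (phi A b lambda xs) => _ [y _ <-] | exists xs].
by apply: lb_le_inf => [|_ [y _ <-]//]; exists (phi A b lambda xs), xs.
Qed.

(** * The proximal step *)

(** Scalar soft thresholding, in its variational form [v = q + tau * s] with
    [s] a subgradient of the absolute value at [q]. *)
Lemma soft_threshold (v tau : R) : 0 < tau ->
  exists qs : R * R, [/\ `|qs.2| <= 1, qs.2 * qs.1 = `|qs.1| &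
    qs.1 + tau * qs.2 = v].
Proof.
move=> t0; have [vt|vt] := ltP tau v.
  by exists (v - tau, 1) => /=; rewrite normr1; split; rewrite ?ger0_norm; lra.
have [vt'|vt'] := ltP v (- tau).
  exists (v + tau, -1) => /=; rewrite normrN1.
  by split; rewrite ?ler0_norm; lra.
exists (0, v / tau); rewrite /= mulr0 normr0 add0r; split=> //.
  by rewrite normrM normfV (gtr0_norm t0) ler_pdivrMr // mul1r ler_norml vt'.
by field; lra.
Qed.

Lemma psi_self lambda L x : psi A b lambda L x x = phi A b lambda x.
Proof. by rewrite /psi subrr dot0r norm2_sqr dot0r mulr0 !addr0. Qed.

(** First-order optimality of a point [p] for the strongly convex model gives
    minimality with quadratic growth. *)
Lemma psi_quadratic_growth lambda L x p xi : 0 < lambda -> 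
  subdiff (@norm1 R n) p xi ->
  grad_lsq A b x + L *: (p - x) + lambda *: xi = 0 ->
  forall y, psi A b lambda L x p + L / 2 * dot (y - p) (y - p)
              <= psi A b lambda L x y.
Proof.
move=> l0 sub opt y; rewrite /psi !norm2_sqr.
have -> : y - x = (p - x) + (y - p) by rewrite [RHS]addrC addrA subrK.
have := sub y; rewrite -(ler_pM2l l0) mulrDr.
have := congr1 (fun u => dot u (y - p)) opt.
move: (y - p) (p - x) => d e.
rewrite /= [dot 0 _]dotC dot0r !dotDl !dotZl !dotDr (dotC d e); lra.
Qed.

Lemma prox_spec lambda L x (p := prox A b lambda L x) : 0 < lambda -> 0 < L ->
  (exists2 xi, subdiff (@norm1 R n) p xi &
     grad_lsq A b x + L *: (p - x) + lambda *: xi = 0) /\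
  forall y, psi A b lambda L x p + L / 2 * dot (y - p) (y - p)
              <= psi A b lambda L x y.
Proof.
move=> l0 L0.
have [qs qsP] := choice (fun j : 'I_n =>
  soft_threshold (x j 0 - grad_lsq A b x j 0 / L) (divr_gt0 l0 L0)).
pose q : 'cV[R]_n := \col_j (qs j).1; pose xi : 'cV[R]_n := \col_j (qs j).2.
have sub : subdiff (@norm1 R n) q xi.
  by apply/subdiff_norm1P => j; have [s1 s2 _] := qsP j; rewrite !mxE.
have opt : grad_lsq A b x + L *: (q - x) + lambda *: xi = 0.
  apply/colP => j; have [_ _] := qsP j.
  rewrite !mxE; move: (\sum_i _) => g.
  move/(canRL (addrK _)) => ->; field; lra.
have growth := psi_quadratic_growth l0 sub opt.
have min_q : argmin (psi A b lambda L x) q.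
  by move=> y; apply: le_trans (growth y); rewrite lerDl mulr_ge0 ?dot_ge0; lra.
suff -> : p = q by split=> //; exists xi.
apply: (xget_unique _ min_q) => y min_y.
apply/eqP; rewrite -subr_eq0; apply/eqP/dot_eq0.
have L20 : 0 < L / 2 by rewrite divr_gt0.
apply/eqP; rewrite eq_le dot_ge0 andbT -(pmulr_rle0 _ L20).
by have := growth y; have := min_y q; lra.
Qed.

Lemma phi_prox_le_psi_iff lambda L x (p := prox A b lambda L x) :
  (phi A b lambda p <= psi A b lambda L x p) =
  (energy (p - x) <= L * dot (p - x) (p - x)).
Proof.
rewrite /phi /psi (lsqE x p) norm2_sqr.
by apply/idP/idP; lra.
Qed.

(** Quadratic growth of the model around its minimizer, evaluated at [x], where
    the model takes the value of the objective. *)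
Lemma phi_prox_decrease lambda L x (p := prox A b lambda L x) :
  0 < lambda -> 0 < L ->
  phi A b lambda p <= psi A b lambda L x p ->
  phi A b lambda p + L / 2 * dot (p - x) (p - x) <= phi A b lambda x.
Proof.
move=> l0 L0 acc; have [_ /(_ x)] := prox_spec x l0 L0.
rewrite psi_self -/p -(opprB p x) dotNl dotNr opprK; lra.
Qed.

Lemma prox_fixpoint_residue0 lambda L x : 0 < lambda -> 0 < L ->
  prox A b lambda L x = x -> omega A b lambda x = 0.
Proof.
move=> l0 L0 fix_x; have [[xi sub opt] _] := prox_spec x l0 L0.
rewrite fix_x in sub opt; rewrite subrr scaler0 addr0 in opt.
apply/eqP; rewrite eq_le residue_ge0 // andbT.
by apply: le_trans (residue_le_norm _ sub) _; rewrite opt normr0.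
Qed.

Lemma residue0_min lambda x y : 0 < lambda -> omega A b lambda x = 0 ->
  phi A b lambda x <= phi A b lambda y.
Proof.
move=> l0 w0; rewrite -subr_le0 -(mul0r (norm1 (x - y))) -w0.
exact: phi_gap_le_residue.
Qed.

End CompositeObjective.

(** * Restricted eigenvalues *)

Section Supports.
Variables (R : realType) (n : nat).
Implicit Types (x y : 'cV[R]_n) (S : {set 'I_n}).

Lemma supp_restrC S x : supp (restr (~: S) x) = supp x :\: S.
Proof.
apply/setP => j; rewrite !inE mxE !inE.
by case: (j \in S); rewrite //= eqxx.
Qed.

Lemma norm0_off S x : norm0 (restr (~: S) x) = #|supp x :\: S|.
Proof. by rewrite /norm0 supp_restrC. Qed.

Lemma suppB x y : supp (x - y) \subset supp x :|: supp y.
Proof.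
apply/fintype.subsetP => j; rewrite !inE !mxE -negb_and; apply: contra.
by move=> /andP[/eqP-> /eqP->]; rewrite subrr.
Qed.

Lemma supp0 : supp (0 : 'cV[R]_n) = finset.set0.
Proof. by apply/setP => j; rewrite !inE mxE eqxx. Qed.

Lemma norm0_le_off S x (s : nat) :
  (#|supp x :\: S| <= s)%N -> (norm0 x <= #|S| + s)%N.
Proof.
move=> xs; rewrite /norm0 -(cardsID S (supp x)) leq_add //.
by rewrite subset_leq_card // finset.subsetIr.
Qed.

Lemma supp_off_subB S x y :
  (#|supp (x - y) :\: S| <= #|supp x :\: S| + #|supp y :\: S|)%N.
Proof.
apply: leq_trans (leq_card_setU _ _); rewrite -finset.setDUl.
by apply: subset_leq_card; rewrite finset.setSD // suppB.
Qed.

Lemma norm0_delta (j : 'I_n) : norm0 (delta_mx j 0 : 'cV[R]_n) = 1%N.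
Proof.
rewrite /norm0 (_ : supp _ = [set j]%SET) ?cards1 //; apply/setP => i.
by rewrite !inE mxE eqxx andbT pnatr_eq0 eqb0 negbK.
Qed.

End Supports.

Section RestrictedEigenvalueBounds.
Variables (R : realType) (m n : nat) (A : 'M[R]_(m, n)).
Implicit Types (x d : 'cV[R]_n) (s : nat).

Lemma energy_bounded : exists c : R, forall x, energy A x <= c * dot x x.
Proof.
exists (\sum_i dot (row i A)^T (row i A)^T) => x.
rewrite mulr_suml /energy {1}/dot; apply: ler_sum => i _.
have -> : (A *m x) i 0 = dot (row i A)^T x.
  by rewrite mxE; apply: eq_bigr => j _; rewrite !mxE.
by rewrite -expr2 Cauchy_Schwarz.
Qed.

Lemma dot_gt0 x : x != 0 -> 0 < dot x x.
Proof.
move=> x0; rewrite lt_def dot_ge0 andbT.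
by apply: contra x0 => /eqP/dot_eq0/eqP.
Qed.

Lemma rayleighE x : dot x (A^T *m A *m x) = energy A x.
Proof. by rewrite -mulmxA -dot_mulmx. Qed.

Lemma rayleigh_ubound s : has_ubound (sparse_rayleigh A s).
Proof.
have [c cP] := energy_bounded.
by exists c => _ [x [/eqP x0 _] <-]; rewrite rayleighE ler_pdivrMr ?dot_gt0.
Qed.

Lemma rayleigh_lbound s : lbound (sparse_rayleigh A s) 0.
Proof.
by move=> _ [x _ <-]; rewrite rayleighE divr_ge0 ?energy_ge0 ?dot_ge0.
Qed.

Lemma rayleigh_mem s x : x != 0 -> (norm0 x <= s)%N ->
  sparse_rayleigh A s (energy A x / dot x x).
Proof. by move=> /eqP x0 xs; exists x; rewrite ?rayleighE. Qed.

Lemma energy_le_rho_plus s x : (norm0 x <= s)%N ->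
  energy A x <= rho_plus A s * dot x x.
Proof.
move=> xs; have [->|x0] := eqVneq x 0.
  by rewrite /energy mulmx0 !dot0r mulr0.
rewrite -ler_pdivrMr ?dot_gt0 //.
exact/ub_le_sup/rayleigh_mem/xs/x0/rayleigh_ubound.
Qed.

Lemma rho_minus_le_energy s x : (norm0 x <= s)%N ->
  rho_minus A s * dot x x <= energy A x.
Proof.
move=> xs; have [->|x0] := eqVneq x 0.
  by rewrite /energy mulmx0 !dot0r mulr0.
rewrite -ler_pdivlMr ?dot_gt0 //; apply: ge_inf; last exact: rayleigh_mem.
by exists 0; exact: rayleigh_lbound.
Qed.

Lemma rho_plus_ge0 s : 0 <= rho_plus A s.
Proof.
have [r0|/set0P[t st]] := eqVneq (sparse_rayleigh A s) set0.
  by rewrite /rho_plus r0 sup0.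
by apply: le_trans (rayleigh_lbound st) (ub_le_sup (rayleigh_ubound s) st).
Qed.

Lemma rayleigh_nonempty s (j : 'I_n) : (0 < s)%N ->
  exists t, sparse_rayleigh A s t.
Proof.
move=> s0; eexists; apply: (@rayleigh_mem s (delta_mx j 0)).
  by apply/eqP => /colP/(_ j)/eqP; rewrite !mxE !eqxx oner_eq0.
by rewrite norm0_delta.
Qed.

Lemma rho_minus_anti s s' (j : 'I_n) : (0 < s <= s')%N ->
  rho_minus A s' <= rho_minus A s.
Proof.
case/andP=> s0 ss'; apply: lb_le_inf; first exact: rayleigh_nonempty.
move=> _ [x [x0 xs] <-]; apply: ge_inf.
  by exists 0; exact: rayleigh_lbound.
by exists x => //; split=> //; exact: leq_trans ss'.
Qed.

Lemma rho_minus_le_plus s (j : 'I_n) : (0 < s)%N ->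
  rho_minus A s <= rho_plus A s.
Proof.
move=> /(rayleigh_nonempty j)[t st].
apply: le_trans (ub_le_sup (rayleigh_ubound s) st).
by apply: ge_inf st; exists 0; exact: rayleigh_lbound.
Qed.

(** Each entry of [A^T A d] is the scalar product of a column of [A], the image
    of a 1-sparse vector, with [A d]. *)
Lemma norm_gram_sqr_le s d : (0 < s)%N -> (norm0 d <= s)%N ->
  `|A^T *m (A *m d)| ^+ 2 <= rho_plus A s ^+ 2 * dot d d.
Proof.
move=> s0 ds.
have := rho_plus_ge0 s; have := energy_le_rho_plus ds.
set r := rho_plus A s => dr r0.
have rd0 : 0 <= r ^+ 2 * dot d d by rewrite mulr_ge0 ?dot_ge0 ?sqr_ge0.
rewrite -(sqr_sqrtr rd0) ler_sqr ?nnegrE ?sqrtr_ge0 //.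
apply: norm_le => [|j]; first exact: sqrtr_ge0.
rewrite -sqrtr_sqr ler_wsqrtr // -dot_delta -dot_mulmx.
apply: le_trans (Cauchy_Schwarz _ _) _.
have ej : energy A (delta_mx j 0) <= r.
  have := @energy_le_rho_plus s (delta_mx j 0).
  by rewrite norm0_delta dot_delta mxE !eqxx mulr1; apply.
rewrite expr2 -mulrA; apply: ler_pM ej dr; exact: energy_ge0.
Qed.

End RestrictedEigenvalueBounds.

(** * Estimation error of approximate solutions *)

Lemma le_AMGM (R : realFieldType) (t w q c : R) : 0 < c -> 0 <= w -> 0 <= q ->
  t ^+ 2 <= w * q -> t <= c * q + (4 * c)^-1 * w.
Proof.
move=> c0 w0 q0 twq; have d0 : 0 < (4 * c)^-1 by rewrite invr_gt0; lra.
have rhs0 : 0 <= c * q + (4 * c)^-1 * w.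
  by rewrite addr_ge0 // mulr_ge0 // ltW.
rewrite real_leNgt ?num_real //; apply/negP => lt_t.
have : (c * q + (4 * c)^-1 * w) ^+ 2 < t ^+ 2.
  by rewrite ltr_pXn2r ?nnegrE //; apply: ltW; apply: le_lt_trans lt_t.
apply/negP; rewrite -leNgt; apply: le_trans twq _.
have -> : w * q = 4 * (c * q * ((4 * c)^-1 * w)) by field; lra.
move: (c * q) (_ * w) => u v; have := sqr_ge0 (u - v); lra.
Qed.

(** What the noise condition at the target parameter yields at every larger
    [lambda]. *)
Record lasso_regime (R : realType) (gamma delta' noise lambda : R) : Prop :=
  LassoRegime {
    regime_gamma : 0 < gamma;
    regime_delta' : 0 < delta';
    regime_slope : 0 < (1 - delta') * gamma - (1 + delta');
    regime_lambda : 0 < lambda;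
    regime_noise4 : 4 * noise <= lambda;
    regime_noise : (gamma + 1) * noise
      <= ((1 - delta') * gamma - (1 + delta')) * lambda
  }.

Section LinearModel.
Variables (R : realType) (m n : nat) (A : 'M[R]_(m, n)) (b z : 'cV[R]_m).
Variable (xbar : 'cV[R]_n).
Hypothesis hb : b = A *m xbar + z.
Implicit Types (x xi : 'cV[R]_n) (lambda : R).

Let S := supp xbar.
Let noise := `|A^T *m z|.

Definition err_on x : R := \sum_(j in S) `|(x - xbar) j 0|.
Definition err_off x : R := \sum_(j in ~: S) `|(x - xbar) j 0|.

Lemma err_on_ge0 x : 0 <= err_on x. Proof. exact: sumr_ge0. Qed.
Lemma err_off_ge0 x : 0 <= err_off x. Proof. exact: sumr_ge0. Qed.

Lemma norm1_err x : norm1 (x - xbar) = err_on x + err_off x.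
Proof.
rewrite /norm1 (bigID (mem S)) /=; congr (_ + _).
by apply: eq_bigl => j; rewrite finset.in_setC.
Qed.

Lemma xbar_off j : j \in ~: S -> xbar j 0 = 0.
Proof. by rewrite !inE negbK => /eqP. Qed.

Lemma residual_model x : A *m x - b = A *m (x - xbar) - z.
Proof. by rewrite hb mulmxBr opprD addrA. Qed.

Lemma grad_model x : grad_lsq A b x = A^T *m (A *m (x - xbar)) - A^T *m z.
Proof. by rewrite /grad_lsq residual_model mulmxBr. Qed.

Lemma lsq_model x : lsq A b x - lsq A b xbar =
  energy A (x - xbar) / 2 - dot (A^T *m z) (x - xbar).
Proof.
by rewrite (lsqE A b xbar x) grad_model subrr !mulmx0 sub0r dotNl; lra.
Qed.

Lemma noise_term x :
  `|dot (A^T *m z) (x - xbar)| <= noise * (err_on x + err_off x).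
Proof. by rewrite -norm1_err dot_le_norm1. Qed.

Lemma subgradient_err x xi : subdiff (@norm1 R n) x xi ->
  err_off x - err_on x <= dot xi (x - xbar).
Proof.
move=> /subdiff_norm1P sub.
have -> : dot xi (x - xbar) = \sum_(j in S) xi j 0 * (x - xbar) j 0
    + \sum_(j in ~: S) xi j 0 * (x - xbar) j 0.
  rewrite /dot (bigID (mem S)) /=; congr (_ + _).
  by apply: eq_bigl => j; rewrite finset.in_setC.
rewrite addrC lerD //; last first.
  apply: ler_sum => j /xbar_off xj; rewrite mxE [(- xbar) j 0]mxE xj subr0.
  by have [_ ->] := sub j.
rewrite -sumrN; apply: ler_sum => j _; have [xi1 _] := sub j.
rewrite lerNl; apply: le_trans (ler_norm _) _; rewrite normrN normrM.
by rewrite -[leRHS]mul1r ler_wpM2r.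
Qed.

Lemma norm1_diff x : err_off x - err_on x <= norm1 x - norm1 xbar.
Proof.
rewrite /norm1 -sumrB (bigID (mem S)) /= addrC lerD //.
  rewrite [leRHS](eq_bigl (fun j => j \in ~: S)); last first.
    by move=> j; rewrite finset.in_setC.
  by apply: ler_sum => j /xbar_off xj; rewrite !mxE xj subr0 normr0 subr0.
rewrite -sumrN; apply: ler_sum => j _; rewrite !mxE lerNl opprB distrC.
exact: lerB_dist.
Qed.

(** The basic inequality: pairing the nearly vanishing subgradient of the
    objective at [x] with the error [x - xbar]. *)
Lemma residue_err_ineq lambda x : 0 < lambda ->
  energy A (x - xbar) + (lambda - omega A b lambda x - noise) * err_off x
    <= (lambda + omega A b lambda x + noise) * err_on x.
Proof.
move=> l0; have [xi sub ->] := residue_attained A b x l0.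
set g := grad_lsq A b x + _; have := dot_le_norm1 g (x - xbar).
move=> /(le_trans (ler_norm _)); rewrite norm1_err {1}/g dotDl dotZl grad_model.
rewrite dotDl dotNl -(dotC (x - xbar)) -dot_mulmx -/(energy A (x - xbar)).
have := subgradient_err sub; rewrite -(ler_pM2l l0).
have := le_trans (ler_norm _) (noise_term x); lra.
Qed.

Lemma phi_err_ineq lambda x : 0 < lambda ->
  energy A (x - xbar) / 2 + (lambda - noise) * err_off x
    <= (lambda + noise) * err_on x + (phi A b lambda x - phi A b lambda xbar).
Proof.
move=> l0; have := norm1_diff x; rewrite -(ler_pM2l l0).
have := le_trans (ler_norm _) (noise_term x).
have := lsq_model x; rewrite /phi; lra.
Qed.

(** Pairing with the sign vector of [T] sums the entries of [A^T A d] over [T];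
    that vector is [#|T|]-sparse, so its image under [A] is controlled by
    [rho_plus]. *)
Lemma gram_count (T : {set 'I_n}) (st : nat) lambda d : 0 < lambda ->
  (#|T| <= st)%N ->
  (forall j, j \in T -> lambda / 2 <= `|(A^T *m (A *m d)) j 0|) ->
  #|T|%:R * lambda ^+ 2 <= 4 * rho_plus A st * energy A d.
Proof.
move=> l0 Ts Tl; set h := A^T *m _ in Tl.
have [T0|T0] := posnP #|T|.
  by rewrite T0 mul0r !mulr_ge0 ?rho_plus_ge0 ?energy_ge0.
pose u : 'cV[R]_n := \col_j (if j \in T then Num.sg (h j 0) else 0).
have su : (norm0 u <= st)%N.
  apply: leq_trans Ts; apply/subset_leq_card/fintype.subsetP => j.
  by rewrite !inE mxE; case: ifP; rewrite // eqxx.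
have uu : dot u u <= #|T|%:R.
  rewrite -sum1_card natr_sum [leRHS]big_mkcond; apply: ler_sum => j _.
  rewrite mxE; case: ifP => _; last by rewrite mul0r.
  by rewrite -expr2 sqr_sg; case: (_ != 0).
have uh : #|T|%:R * (lambda / 2) <= dot (A *m u) (A *m d).
  rewrite dot_mulmx -/h -sum1_card natr_sum mulr_suml big_mkcond.
  apply: ler_sum => j _; rewrite mxE.
  case: ifP => [/Tl|_]; last by rewrite mul0r.
  by rewrite mul1r -normrEsg.
have T0' : 0 < #|T|%:R :> R by rewrite ltr0n.
have : (#|T|%:R * (lambda / 2)) ^+ 2 <= rho_plus A st * #|T|%:R * energy A d.
  apply: (@le_trans _ _ (dot (A *m u) (A *m d) ^+ 2)).
    have lhs0 : 0 <= #|T|%:R * (lambda / 2) by rewrite mulr_ge0 //; lra.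
    by rewrite ler_sqr ?nnegrE // (le_trans lhs0).
  apply: le_trans (Cauchy_Schwarz _ _) _; rewrite ler_wpM2r ?energy_ge0 //.
  apply: le_trans (energy_le_rho_plus A su) _.
  by rewrite ler_wpM2l ?rho_plus_ge0.
rewrite -(ler_pM2l T0'); move: (#|T|%:R) T0' => k k0.
set e := rho_plus _ _; set f := energy _ _ => le_k.
rewrite -(ler_pM2l k0); move: le_k; rewrite ler_pM2l //; lra.
Qed.

Section Sparse.
Variables (st : nat) (gamma delta' lambda : R).
Let rho := rho_minus A (norm0 xbar + st).
Hypothesis rho_gt0 : 0 < rho.
Hypothesis regime : lasso_regime gamma delta' noise lambda.

Definition sparse_off x := (#|supp x :\: supp xbar| <= st)%N.

(** The squared scale of the statistical error: up to constants it bounds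
    the prediction error and the l1 error times [lambda]. *)
Definition err_scale : R := lambda ^+ 2 * (norm0 xbar)%:R / rho.
Let w := err_scale.

Lemma err_scale_ge0 : 0 <= w.
Proof. exact: divr_ge0 (mulr_ge0 (sqr_ge0 _) (ler0n _ _)) (ltW rho_gt0). Qed.

Lemma sparse_xbar : sparse_off xbar.
Proof. by rewrite /sparse_off finset.setDv cards0. Qed.

Lemma norm0_err x : sparse_off x -> (norm0 (x - xbar) <= norm0 xbar + st)%N.
Proof.
move=> sx; apply: norm0_le_off; apply: leq_trans (supp_off_subB _ _ _) _.
by rewrite finset.setDv cards0 addn0.
Qed.

Lemma dot_err_le_energy x : sparse_off x ->
  rho * dot (x - xbar) (x - xbar) <= energy A (x - xbar).
Proof. by move=> /norm0_err; exact: rho_minus_le_energy. Qed.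

Lemma err_on_sqr_le x : sparse_off x ->
  (lambda * err_on x) ^+ 2 <= w * energy A (x - xbar).
Proof.
have r0 := rho_gt0.
have [g0 d0 slope l0 n4 ng] := regime.
move=> sx; have := sqr_norm1_on_le S (x - xbar); rewrite -/(err_on x) => on2.
have := dot_err_le_energy sx; rewrite -ler_pdivlMl // => de.
have -> : w * energy A (x - xbar) =
    lambda ^+ 2 * ((norm0 xbar)%:R * (rho^-1 * energy A (x - xbar))).
  by rewrite /w /err_scale; ring.
rewrite exprMn ler_wpM2l ?sqr_ge0 //.
by apply: le_trans on2 _; rewrite ler_wpM2l.
Qed.

Lemma err_cone x : omega A b lambda x <= delta' * lambda ->
  err_off x <= gamma * err_on x /\ energy A (x - xbar) <= 2 * lambda * err_on x.
Proof.
have r0 := rho_gt0.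
have [g0 d0 slope l0 n4 ng] := regime.
move=> wx; have := residue_err_ineq x l0.
have := err_on_ge0 x; have := err_off_ge0 x; have := energy_ge0 A (x - xbar).
move: (err_on x) (err_off x) (energy _ _) => c a q q0 a0 c0 ineq.
have nu0 : 0 <= noise by exact: normr_ge0.
have g1 : 0 < gamma + 1 by lra.
(* In units of lambda, the margin p is at least 2/(gamma+1) and the slope r at
   most 2 gamma/(gamma+1). *)
pose p := (1 - delta') * lambda - noise.
pose r := (1 + delta') * lambda + noise.
have pP : 2 * lambda <= (gamma + 1) * p by rewrite /p; lra.
have rP : (gamma + 1) * r <= 2 * gamma * lambda by rewrite /r; lra.
have p0 : 0 < p by rewrite -(pmulr_rgt0 _ g1); lra.
have pr : q + p * a <= r * c.
  have := ler_wpM2r a0 wx; have := ler_wpM2r c0 wx; rewrite /p /r; lra.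
have rgp : r <= gamma * p.
  rewrite -(ler_pM2l g1); apply: le_trans rP _.
  by have := ler_wpM2l (ltW g0) pP; lra.
split.
  rewrite -(ler_pM2l p0); apply: (@le_trans _ _ (r * c)); first lra.
  by rewrite mulrA [p * _]mulrC ler_wpM2r.
have r2 : r <= 2 * lambda by rewrite -(ler_pM2l g1); lra.
have pa0 : 0 <= p * a by rewrite mulr_ge0 // ltW.
by have := ler_wpM2r c0 r2; lra.
Qed.

(** On sparse vectors the prediction error dominates the l2 error, hence also
    the l1 error on the support; the cone condition does the rest. *)
Lemma err_bounds x : sparse_off x -> omega A b lambda x <= delta' * lambda ->
  [/\ lambda * norm1 (x - xbar) <= 2 * (1 + gamma) * w &
      norm2 (x - xbar) <= 2 * lambda * Num.sqrt (norm0 xbar)%:R / rho].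
Proof.
have r0 := rho_gt0.
have [g0 d0 slope l0 n4 ng] := regime.
move=> sx /err_cone[a_le q_le]; have on2 := err_on_sqr_le sx.
have w0 := err_scale_ge0; rewrite -/w in w0.
have q0 := energy_ge0 A (x - xbar).
have h4 : (0 : R) < 1 / 4 by lra.
have lc_le : lambda * err_on x <= 2 * w.
  by have := le_AMGM h4 w0 q0 on2; lra.
have q4 : energy A (x - xbar) <= 4 * w by lra.
split.
  rewrite norm1_err; have := ler_wpM2l (ltW l0) a_le.
  by have := ler_wpM2l (ltW g0) lc_le; lra.
have rhs0 : 0 <= 2 * lambda * Num.sqrt (norm0 xbar)%:R / rho.
  by rewrite divr_ge0 ?mulr_ge0 ?sqrtr_ge0 //; lra.
rewrite -ler_sqr ?nnegrE ?sqrtr_ge0 // norm2_sqr.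
rewrite -(ler_pM2l rho_gt0); apply: le_trans (dot_err_le_energy sx) _.
move: q4; rewrite expr_div_n !exprMn sqr_sqrtr // /w /err_scale.
by congr (_ <= _); field; lra.
Qed.

(** The bound that [phi_start] gives for the objective excess over [xbar]. *)
Definition excess : R := 2 * delta' * (1 + gamma) * w.

Lemma excess_ge0 : 0 <= excess.
Proof.
have [g0 d0 _ _ _ _] := regime.
by rewrite mulr_ge0 ?err_scale_ge0 // mulr_ge0; lra.
Qed.

(** The lower bound on [gamma] keeps [delta'] away from 1, which leaves the room
    needed in [err_of_phi_le] whatever the size of [gamma]. *)
Lemma excess_le : excess <= 2 * (gamma - 1) * w.
Proof.
by have [_ _ slope _ _ _] := regime; rewrite ler_wpM2r ?err_scale_ge0 //; lra.
Qed.

Lemma phi_start x : sparse_off x -> omega A b lambda x <= delta' * lambda ->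
  phi A b lambda x <= phi A b lambda xbar + excess.
Proof.
have r0 := rho_gt0.
have [g0 d0 slope l0 n4 ng] := regime.
move=> sx wx; have [le1 _] := err_bounds sx wx.
have := phi_gap_le_residue A b x xbar l0.
have := ler_wpM2r (norm1_ge0 (x - xbar)) wx.
have := ler_wpM2l (ltW d0) le1; rewrite /excess; lra.
Qed.

Lemma gamma_gt1 : 1 < gamma.
Proof. by have [g0 d0 slope l0 n4 ng] := regime; nra. Qed.

(** A Lasso-type estimate from the objective value alone. It persists along a
    decreasing sequence of objective values, unlike the cone condition, which
    needs a small residue. *)
Lemma err_of_phi_le x : sparse_off x ->
  phi A b lambda x <= phi A b lambda xbar + excess ->
  energy A (x - xbar) <= 8 * (1 + gamma) * w /\
  lambda * err_off x <= 4 * (1 + gamma) * w.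
Proof.
have r0 := rho_gt0.
have [g0 d0 slope l0 n4 ng] := regime.
move=> sx phix; have on2 := err_on_sqr_le sx.
have w0 := err_scale_ge0; rewrite -/w in w0.
have q0 := energy_ge0 A (x - xbar).
have a0 := err_off_ge0 x; have c0 := err_on_ge0 x.
have := phi_err_ineq x l0; have := excess_le.
have na := ler_wpM2r a0 n4; have nc := ler_wpM2r c0 n4.
have la0 : 0 <= lambda * err_off x by rewrite mulr_ge0 // ltW.
have gw : 2 * w <= (1 + gamma) * w.
  by rewrite ler_wpM2r //; have := gamma_gt1; lra.
(* The weights 1/5 and 2/5 leave a quarter of the prediction error in the first
   bound and none of it in the second. *)
have h1 : (0 : R) < 1 / 5 by lra.
have h2 : (0 : R) < 2 / 5 by lra.
by split; [have := le_AMGM h1 w0 q0 on2|have := le_AMGM h2 w0 q0 on2]; lra.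
Qed.

(** Applied to a sparse minimizer and combined with [phi_start], this bounds the
    initial gap of a stage without any estimate on the minimizer. *)
Lemma phi_xbar_le x : sparse_off x ->
  phi A b lambda xbar <= phi A b lambda x + 25 / 32 * w.
Proof.
have r0 := rho_gt0.
have [g0 d0 slope l0 n4 ng] := regime.
move=> sx; have on2 := err_on_sqr_le sx.
have w0 := err_scale_ge0; rewrite -/w in w0.
have q0 := energy_ge0 A (x - xbar).
have a0 := err_off_ge0 x; have c0 := err_on_ge0 x.
have := phi_err_ineq x l0.
have na := ler_wpM2r a0 n4; have nc := ler_wpM2r c0 n4.
have la0 : 0 <= lambda * err_off x by rewrite mulr_ge0 // ltW.
have h2 : (0 : R) < 2 / 5 by lra.
have := le_AMGM h2 w0 q0 on2; lra.
Qed.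

(** * Proximal steps preserve sparsity *)

Variable Lmax : R.
Hypothesis st_large :
  16 * (Lmax + 2 * rho_plus A st) / rho * (1 + gamma) * (norm0 xbar)%:R < st%:R.

(** A coordinate outside the support of [xbar] survives soft thresholding only
    if the gradient step moves it beyond [lambda / L]; the noise accounts for a
    quarter of that, so either the coordinate of [x] or that of the noiseless
    gradient is large. The l1 error bounds the number of the former, the
    prediction error that of the latter. *)
Lemma prox_sparse L x : 0 < L <= Lmax -> sparse_off x ->
  phi A b lambda x <= phi A b lambda xbar + excess ->
  sparse_off (prox A b lambda L x).
Proof.
have r0 := rho_gt0.
have [g0 d0 slope l0 n4 ng] := regime.
case/andP=> L0 Lle sx phix; have [q_le a_le] := err_of_phi_le sx phix.
have [[xi /subdiff_norm1P sub opt] _] := prox_spec A b x l0 L0.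
set p := prox A b lambda L x in sub opt *.
pose h := A^T *m (A *m (x - xbar)).
pose J := supp p :\: S.
pose J1 := [set j in J | lambda / 4 <= L * `|(x - xbar) j 0|]%SET.
pose J2 := [set j in J | lambda / 2 <= `|h j 0|]%SET.
have JU : J \subset J1 :|: J2.
  apply/fintype.subsetP => j jJ.
  rewrite finset.in_setU {1}/J1 {1}/J2 2!finset.in_set jJ /=.
  apply: contraT; rewrite negb_or -!ltNge => /andP[lt1 lt2].
  have [pj xj] : p j 0 != 0 /\ xbar j 0 = 0.
    by move: jJ; rewrite !inE negbK => /andP[/eqP].
  have [_ xip] := sub j.
  have xi_sg : xi j 0 = Num.sg (p j 0).
    by apply: (mulIf pj); rewrite xip -normrEsg.
  have nj := entry_le_norm (A^T *m z) j; rewrite -/noise in nj.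
  have : h j 0 - (A^T *m z) j 0 + L * (p j 0 - x j 0) + lambda * xi j 0 = 0.
    by have /colP/(_ j) := opt; rewrite grad_model /h !mxE.
  move: lt1 lt2 nj; rewrite -[L in L * `|_|](gtr0_norm L0) -normrM.
  rewrite mxE [(- xbar) j 0]mxE xj subr0 !ltr_norml !ler_norml.
  rewrite xi_sg; move: (h j 0) ((A^T *m z) j 0) => hj zj.
  move=> /andP[x1 x2] /andP[h1 h2] /andP[z1 z2].
  have [p0|p0|p0] := sgrP (p j 0); [by rewrite p0 eqxx in pj|..].
    by have := mulr_gt0 L0 p0; lra.
  by have := mulr_gt0 L0 (etrans (oppr_gt0 _) p0); lra.
have w0 := err_scale_ge0; rewrite -/w in w0.
have rp0 := rho_plus_ge0 A st.
have st_gt : 16 * (Lmax + 2 * rho_plus A st) * (1 + gamma) * w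
    < st%:R * lambda ^+ 2.
  have := st_large; rewrite -(ltr_pM2r (exprn_gt0 2 l0)).
  congr (_ < _); rewrite /w /err_scale; field; lra.
have J1_le : #|J1|%:R * lambda ^+ 2 <= 16 * Lmax * (1 + gamma) * w.
  have : #|J1|%:R * (lambda / 4) <= L * err_off x.
    rewrite -sum1_card natr_sum mulr_suml /err_off mulr_sumr.
    rewrite [leLHS]big_mkcond [leRHS]big_mkcond; apply: ler_sum => j _.
    rewrite mul1r finset.in_set /J finset.in_setD finset.in_setC /S.
    case: (j \in supp xbar) => //=; case: ifP => [/andP[_]//|_].
    by rewrite mulr_ge0 // ltW.
  rewrite -(ler_pM2l l0) => J1_le.
  have := ler_wpM2l (ltW L0) a_le.
  have gw0 : 0 <= (1 + gamma) * w by rewrite mulr_ge0 //; lra.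
  by have := ler_wpM2r gw0 Lle; lra.
have J2_count (T : {set 'I_n}) : T \subset J2 -> (#|T| <= st)%N ->
    #|T|%:R * lambda ^+ 2 <= 32 * rho_plus A st * (1 + gamma) * w.
  move=> TJ Ts; have := gram_count (d := x - xbar) l0 Ts.
  have q_le' := ler_wpM2l rp0 q_le.
  move=> /(_ _)/le_trans; apply=> [j jT|]; last lra.
  by have /fintype.subsetP/(_ j jT) := TJ; rewrite finset.in_set => /andP[].
have gw0 : 0 <= Lmax * (1 + gamma) * w.
  by rewrite mulr_ge0 // mulr_ge0; lra.
(* A subset of J2 with exactly st elements would already violate the count. *)
have J2_lt : (#|J2| <= st)%N.
  rewrite leqNgt; apply/negP => stJ.
  have : (0 < #|[set T : {set 'I_n} | T \subset J2 & #|T| == st]|)%N.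
    by rewrite cards_draws bin_gt0 ltnW.
  case/card_gt0P => T; rewrite inE => /andP[TJ /eqP Ts].
  by have := J2_count T TJ; rewrite Ts leqnn => /(_ isT); lra.
have := J2_count J2 (fintype.subxx _) J2_lt => J2_le.
rewrite /sparse_off -/S -/J; apply: leq_trans (subset_leq_card JU) _.
apply: leq_trans (leq_card_setU _ _) _.
rewrite -(ler_nat R) natrD -(ler_pM2r (exprn_gt0 2 l0)); lra.
Qed.

End Sparse.
End LinearModel.

(** * Existence of a sparse minimizer *)

Section SupportedMinimizer.
Variables (R : realType) (m n : nat) (A : 'M[R]_(m, n)) (b : 'cV[R]_m).
Implicit Types (T : {set 'I_n}) (x y : 'cV[R]_n) (lambda : R).

Lemma sum_continuous (U : topologicalType) (I : finType) (F : I -> U -> R) :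
  (forall i, continuous (F i)) -> continuous (fun u => \sum_i F i u).
Proof.
move=> cF; apply: continuous_big => // -[u v].
by apply: cvgD; [exact: cvg_fst | exact: cvg_snd].
Qed.

Lemma phi_coord_continuous lambda T :
  continuous (fun v : 'rV[R]_n => phi A b lambda (restr T v^T)).
Proof.
have coord (j : 'I_n) : continuous (fun v : 'rV[R]_n => restr T v^T j 0).
  rewrite (_ : (fun v => _) = fun v : 'rV[R]_n => if j \in T then v 0 j else 0).
    case: (j \in T); last exact: cst_continuous.
    exact: (@coord_continuous R 1 n 0 j).
  by apply/funext => v; rewrite !mxE.
have res (i : 'I_m) :
    continuous (fun v : 'rV[R]_n => (A *m restr T v^T - b) i 0).
  rewrite (_ : (fun v => _) =
      fun v : 'rV[R]_n => \sum_j A i j * restr T v^T j 0 - b i 0).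
    move=> v; apply: continuousB; last exact: cst_continuous.
    apply: sum_continuous => j u; apply: continuousM; last exact: coord.
    exact: cst_continuous.
  by apply/funext => v; rewrite !mxE.
have -> : (fun v : 'rV[R]_n => phi A b lambda (restr T v^T)) = fun v =>
    (\sum_i (A *m restr T v^T - b) i 0 * (A *m restr T v^T - b) i 0) * 2^-1
    + lambda * \sum_j `|restr T v^T j 0|.
  by apply/funext => v; rewrite /phi /lsq norm2_sqr.
have sq : continuous (fun v : 'rV[R]_n =>
    \sum_i (A *m restr T v^T - b) i 0 * (A *m restr T v^T - b) i 0).
  by apply: sum_continuous => i v; exact: cvgM (res i v) (res i v).
have ab : continuous (fun v : 'rV[R]_n => \sum_j `|restr T v^T j 0|).
  by apply: sum_continuous => j v; exact: cvg_norm (coord j v).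
by move=> v; exact: cvgD (cvgMr_tmp (sq v)) (cvgMl_tmp (ab v)).
Qed.

Lemma restr_id T x : supp x \subset T -> restr T x = x.
Proof.
move=> /fintype.subsetP xT; apply/colP => j; rewrite mxE; case: ifPn => // jT.
by apply/esym/eqP; apply: contraR jT => xj; apply: xT; rewrite inE.
Qed.

Lemma supp_restr T x : supp (restr T x) \subset T.
Proof.
by apply/fintype.subsetP => j; rewrite inE mxE; case: ifP; rewrite ?eqxx.
Qed.

(** The l1 term makes the objective coercive, so that minimizing over the
    vectors supported in [T] reduces to a compact box. *)
Lemma supported_minimizer lambda T : 0 < lambda ->
  exists2 x, supp x \subset T &
    forall y, supp y \subset T -> phi A b lambda x <= phi A b lambda y.
Proof.
move=> l0; pose B := phi A b lambda 0 / lambda.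
have phi00 : 0 <= phi A b lambda 0.
  apply: le_trans (phi_ge_norm1 A b lambda 0).
  by rewrite mulr_ge0 ?norm1_ge0 // ltW.
have B0 : 0 <= B by rewrite divr_ge0 // ltW.
pose K := [set v : 'rV[R]_n | forall i, v 0 i \in `[- B, B]%R]%classic.
have K0 : K 0 by move=> i; rewrite mxE in_itv /=; lra.
have cK : compact K.
  apply: (@rV_compact _ _ (fun=> [set` `[- B, B]%R]%classic)) => i.
  exact: segment_compact.
have [||v vK vmin] :=
  EVT_min_rV _ cK (f := fun v => phi A b lambda (restr T v^T)).
- by exists 0.
- exact/continuous_subspaceT/phi_coord_continuous.
exists (restr T v^T); first exact: supp_restr.
move=> y yT; have [yB|/existsNP[j yj]] := pselect (forall j, `|y j 0| <= B).
  have := vmin y^T; rewrite /= trmxK (restr_id yT); apply.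
  by rewrite inE => j; rewrite mxE in_itv /= -ler_norml.
have restr0 : restr T (0 : 'rV[R]_n)^T = 0.
  by apply/colP => i; rewrite !mxE if_same.
apply: (@le_trans _ _ (phi A b lambda 0)).
  by have := vmin 0; rewrite restr0; apply; rewrite inE.
apply: le_trans (phi_ge_norm1 A b lambda y).
have yj' : B < `|y j 0| by rewrite ltNge; apply/negP.
apply: (@le_trans _ _ (lambda * `|y j 0|)).
  by rewrite -ler_pdivrMl // mulrC ltW.
by rewrite ler_pM2l // /norm1 (bigD1 j) //= lerDl sumr_ge0.
Qed.

Lemma off_sparse_minimizer lambda (S : {set 'I_n}) (st : nat) : 0 < lambda ->
  exists2 x, (#|supp x :\: S| <= st)%N &
    forall y, (#|supp y :\: S| <= st)%N -> phi A b lambda x <= phi A b lambda y.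
Proof.
move=> l0.
have /choice[xT xTP] : forall T : {set 'I_n}, exists x, supp x \subset T /\
    forall y, supp y \subset T -> phi A b lambda x <= phi A b lambda y.
  by move=> T; have [x ? ?] := supported_minimizer T l0; exists x.
have [|T TP Tmin] := @arg_minP _ _ _ S (fun T => #|T :\: S| <= st)%N
  (fun T => phi A b lambda (xT T)); first by rewrite finset.setDv cards0.
have [sT _] := xTP T.
exists (xT T).
  by apply: leq_trans TP; apply/subset_leq_card/finset.setSD.
move=> y /Tmin le_y; apply: le_trans le_y _.
by have [_] := xTP (supp y); apply.
Qed.

End SupportedMinimizer.

(** * Linear convergence of the proximal-gradient method *)

Lemma geometric_eventually_le (R : realType) (a q e : R) :
  0 <= q < 1 -> 0 < e -> exists k, a * q ^+ k <= e.
Proof.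
move=> /andP[q0 q1] e0.
have /(cvg_geometric a)/cvgrPdist_lt/(_ e e0)[k _ kP] : `|q| < 1.
  by rewrite ger0_norm.
exists k; have := kP k (leqnn k); rewrite sub0r normrN => /ltW.
exact/le_trans/ler_norm.
Qed.

Section ProxGradAnalysis.
Variables (R : realType) (m n : nat) (A : 'M[R]_(m, n)) (b z : 'cV[R]_m).
Variables (xbar : 'cV[R]_n) (st : nat).
Variables (gamma delta' lambda gamma_inc gamma_dec L_min : R).
Implicit Types (x y xp : 'cV[R]_n) (L M : R).

Let sbar := norm0 xbar.
Let rho := rho_minus A (sbar + st).
Let rm := rho_minus A (sbar + 2 * st).
Let rp := rho_plus A (sbar + 2 * st).
Let kappa := rp / rm.
Let Lmax := gamma_inc * rp.
Let w := err_scale A xbar st lambda.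
Let phi_ := phi A b lambda.

Hypothesis hb : b = A *m xbar + z.
Hypothesis regime : lasso_regime gamma delta' `|A^T *m z| lambda.
Hypothesis rm_gt0 : 0 < rm.
Hypothesis rm_le_rho : rm <= rho.
Hypothesis rm_le_rp : rm <= rp.
Hypothesis size_gt0 : (0 < sbar + 2 * st)%N.
Hypothesis gamma_inc_gt1 : 1 < gamma_inc.
Hypothesis gamma_dec_ge1 : 1 <= gamma_dec.
Hypothesis L_min_le : L_min <= Lmax.
Hypothesis st_large :
  16 * (Lmax + 2 * rho_plus A st) / rho * (1 + gamma) * sbar%:R < st%:R.

Let rho_gt0 : 0 < rho. Proof. exact: lt_le_trans rm_le_rho. Qed.
Let rp_gt0 : 0 < rp. Proof. exact: lt_le_trans rm_le_rp. Qed.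
Let lambda_gt0 : 0 < lambda. Proof. by case: regime. Qed.
Let rp_lt_Lmax : rp < Lmax. Proof. by rewrite ltr_pMl. Qed.

(** The invariant of the iterates of a stage. It speaks of the objective, which
    decreases, and not of the residue, which need not. *)
Definition tame x : Prop := sparse_off xbar st x /\
  phi_ x <= phi_ xbar + excess A xbar st gamma delta' lambda.

Lemma prox_off_sparse L x : 0 < L <= Lmax -> tame x ->
  sparse_off xbar st (prox A b lambda L x).
Proof.
by move=> LP [sx phix]; exact: (prox_sparse hb rho_gt0 regime st_large LP).
Qed.

Lemma norm0_diff x y : sparse_off xbar st x -> sparse_off xbar st y ->
  (norm0 (x - y) <= sbar + 2 * st)%N.
Proof.
move=> sx sy; apply: norm0_le_off; apply: leq_trans (supp_off_subB _ _ _) _.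
by rewrite mul2n -addnn leq_add.
Qed.

Lemma line_search_test_large L x (p := prox A b lambda L x) :
  rp <= L <= Lmax -> tame x -> phi_ p <= psi A b lambda L x p.
Proof.
case/andP=> rpL LLmax tx; have L0 : 0 < L by exact: lt_le_trans rpL.
have sp : sparse_off xbar st p by apply: prox_off_sparse; rewrite ?L0.
rewrite /phi_ phi_prox_le_psi_iff.
apply: le_trans (energy_le_rho_plus A (norm0_diff sp (proj1 tx))) _.
by rewrite ler_wpM2r ?dot_ge0.
Qed.

(** A minimizer of the objective over the sparse vectors is a fixed point of a
    proximal step, since that step stays among the sparse vectors. *)
Lemma sparse_minimizer :
  exists2 xs, sparse_off xbar st xs & omega A b lambda xs = 0.
Proof.
have [xs sxs min] := off_sparse_minimizer A b (supp xbar) st lambda_gt0.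
exists xs => //.
have txs : tame xs.
  split=> //; apply: le_trans (min _ (sparse_xbar _ _)) _.
  by rewrite lerDl (excess_ge0 rho_gt0 regime).
have acc : phi_ (prox A b lambda rp xs)
    <= psi A b lambda rp xs (prox A b lambda rp xs).
  by apply: line_search_test_large; rewrite ?lexx ?ltW.
apply: (prox_fixpoint_residue0 lambda_gt0 rp_gt0).
apply/eqP; rewrite -subr_eq0; apply/eqP/dot_eq0/eqP.
have rp2 : 0 < rp / 2 by rewrite divr_gt0.
rewrite eq_le dot_ge0 andbT -(pmulr_rle0 _ rp2).
have := phi_prox_decrease lambda_gt0 rp_gt0 acc.
have /min : sparse_off xbar st (prox A b lambda rp xs).
  by apply: prox_off_sparse; rewrite ?rp_gt0 ?ltW.
rewrite -/phi_; lra.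
Qed.

Section WithMinimizer.
Variable xs : 'cV[R]_n.
Hypothesis sparse_xs : sparse_off xbar st xs.
Hypothesis residue_xs : omega A b lambda xs = 0.

Let min_xs y : phi_ xs <= phi_ y.
Proof. exact: residue0_min. Qed.

Definition gap x : R := phi_ x - phi_ xs.


(** Comparison of the step with the point at fraction [alpha] of the segment
    to the minimizer: restricted strong convexity along the segment pays for
    the quadratic term of the model as long as [alpha <= rm / Lmax]. *)
Lemma gap_contraction L x (p := prox A b lambda L x) : 0 < L <= Lmax ->
  tame x -> phi_ p <= psi A b lambda L x p ->
  gap p <= (1 - 1 / (gamma_inc * kappa)) * gap x.
Proof.
case/andP=> L0 Lle [sx _] acc; set alpha := 1 / _.
have gi := gamma_inc_gt1; have r0 := rm_gt0; have p0 := rp_gt0.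
have alphaE : alpha * Lmax = rm.
  by rewrite /alpha /Lmax /kappa; field; rewrite !gt_eqF //; lra.
have Lmax0 : 0 < Lmax by exact: lt_le_trans L0 Lle.
have a0 : 0 < alpha by rewrite -(pmulr_lgt0 _ Lmax0) alphaE.
have a1 : alpha <= 1.
  rewrite -(ler_pM2r Lmax0) alphaE mul1r.
  by have := rp_lt_Lmax; have := rm_le_rp; lra.
have [_ /(_ (x + alpha *: (xs - x))) model] := prox_spec A b x lambda_gt0 L0.
have {}model : phi_ p <= psi A b lambda L x (x + alpha *: (xs - x)).
  apply: le_trans acc (le_trans _ model); rewrite lerDl mulr_ge0 ?dot_ge0 //.
  by rewrite divr_ge0 // ltW.
have yx : x + alpha *: (xs - x) - x = alpha *: (xs - x).
  by rewrite addrAC subrr add0r.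
move: model; rewrite /psi yx norm2_sqr !dotZr dotZl.
have conv : norm1 (x + alpha *: (xs - x)) <=
    (1 - alpha) * norm1 x + alpha * norm1 xs.
  rewrite (_ : x + _ = (1 - alpha) *: x + alpha *: xs); last first.
    by rewrite scalerBr scalerBl scale1r addrA addrAC.
  apply: le_trans (norm1D _ _) _; rewrite !norm1Z !ger0_norm //; lra.
have {}conv := ler_wpM2l (ltW lambda_gt0) conv.
have strong : rm * dot (xs - x) (xs - x) <= energy A (xs - x).
  exact: rho_minus_le_energy (norm0_diff sparse_xs sx).
have Ldot := ler_wpM2r (dot_ge0 (xs - x)) Lle.
have aL : alpha * (L * dot (xs - x) (xs - x)) <= rm * dot (xs - x) (xs - x).
  apply: le_trans (ler_wpM2l (ltW a0) Ldot) _.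
  by rewrite mulrA alphaE.
have {}aL := ler_wpM2l (ltW a0) (le_trans aL strong).
have := lsqE A b x xs; rewrite /gap /phi_ /phi.
move: (norm1 _) (dot _ _) (energy _ _) conv aL (dot _ _) => n1 d e conv aL g.
by move=> fE; have {}fE := congr1 (fun t => alpha * t) fE; lra.
Qed.

(** The residue at the new point is the image of the step [d] under
    [A^T A - L]. The line-search test forces [L >= rm] unless [d = 0], which
    makes [L + rp <= (1 + kappa) L]. *)
Lemma residue_prox_sqr_le L x (p := prox A b lambda L x) : 0 < L <= Lmax ->
  tame x -> phi_ p <= psi A b lambda L x p ->
  omega A b lambda p ^+ 2 <= 2 * Lmax * (1 + kappa) ^+ 2 * gap x.
Proof.
move=> LP tx acc; have [L0 Lle] := andP LP.
have r0 := rm_gt0; have p0 := rp_gt0.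
have sp : sparse_off xbar st p by apply: prox_off_sparse.
have nd := norm0_diff sp (proj1 tx).
have [[xi sub opt] _] := prox_spec A b x lambda_gt0 L0.
set d := p - x in nd.
have res_le : omega A b lambda p <= `|A^T *m (A *m d)| + L * `|d|.
  apply: le_trans (residue_le_norm _ _ _ sub) _; rewrite -/p.
  have -> : grad_lsq A b p + lambda *: xi = A^T *m (A *m d) + (- L) *: d.
    have -> : lambda *: xi = - (grad_lsq A b x + L *: d).
      by apply/eqP; rewrite -addr_eq0 addrC opt.
    have -> : grad_lsq A b p = grad_lsq A b x + A^T *m (A *m d).
      rewrite /grad_lsq -mulmxDr; congr (_ *m _).
      by rewrite /d mulmxBr [RHS]addrC addrA subrK.
    by rewrite opprD addrACA subrr add0r scaleNr.
  apply: le_trans (ler_normD _ _) _.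
  by rewrite normrZ normrN (gtr0_norm L0).
have dd : `|d| <= Num.sqrt (dot d d).
  apply: norm_le => [|j]; first exact: sqrtr_ge0.
  by rewrite -sqrtr_sqr ler_wsqrtr // entry_sqr_le_dot.
have gd : `|A^T *m (A *m d)| <= rp * Num.sqrt (dot d d).
  rewrite -ler_sqr ?nnegrE ?mulr_ge0 ?sqrtr_ge0 ?(ltW p0) //.
  by rewrite exprMn sqr_sqrtr ?dot_ge0 //; exact: norm_gram_sqr_le size_gt0 nd.
have Lrm : (L + rp) * Num.sqrt (dot d d)
    <= (1 + kappa) * L * Num.sqrt (dot d d).
  have [d0|d0] := eqVneq (dot d d) 0; first by rewrite d0 sqrtr0 !mulr0.
  have dpos : 0 < dot d d by rewrite lt_def d0 dot_ge0.
  rewrite ler_wpM2r ?sqrtr_ge0 //.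
  have rmL : rm <= L.
    rewrite -(ler_pM2r dpos); apply: le_trans (rho_minus_le_energy _ nd) _.
    by rewrite -phi_prox_le_psi_iff.
  have rpE : rp = kappa * rm by rewrite /kappa divfK ?gt_eqF.
  have k0 : 0 <= kappa by rewrite divr_ge0 ?ltW.
  by have := ler_wpM2l k0 rmL; rewrite -rpE; lra.
have k1 : 0 <= 1 + kappa by rewrite addr_ge0 // divr_ge0 ?ltW.
have res_le' : omega A b lambda p <= (1 + kappa) * (L * Num.sqrt (dot d d)).
  by have := ler_wpM2l (ltW L0) dd; lra.
apply: (@le_trans _ _ (((1 + kappa) * (L * Num.sqrt (dot d d))) ^+ 2)).
  rewrite ler_sqr ?nnegrE //; first exact: residue_ge0.
  exact: le_trans (residue_ge0 _ _ _ lambda_gt0) res_le'.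
rewrite !exprMn sqr_sqrtr ?dot_ge0 //.
have dec := phi_prox_decrease lambda_gt0 L0 acc; rewrite -/p -/d -/phi_ in dec.
have {}dec : L * dot d d <= 2 * gap x.
  by have := min_xs p; rewrite /gap; lra.
have -> : (1 + kappa) ^+ 2 * (L ^+ 2 * dot d d) =
  L * (1 + kappa) ^+ 2 * (L * dot d d) by ring.
have -> : 2 * Lmax * (1 + kappa) ^+ 2 * gap x =
  Lmax * (1 + kappa) ^+ 2 * (2 * gap x) by ring.
apply: ler_pM => //.
- by rewrite mulr_ge0 ?sqr_ge0 ?ltW.
- by rewrite mulr_ge0 ?dot_ge0 ?ltW.
- by rewrite ler_wpM2r ?sqr_ge0.
Qed.

Lemma tame_prox L x (p := prox A b lambda L x) : 0 < L <= Lmax ->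
  tame x -> phi_ p <= psi A b lambda L x p -> tame p /\ gap p <= gap x.
Proof.
move=> LP tx acc; have [L0 _] := andP LP.
have le_phi : phi_ p <= phi_ x.
  apply: le_trans (phi_prox_decrease lambda_gt0 L0 acc).
  by rewrite lerDl mulr_ge0 ?dot_ge0 // divr_ge0 // ltW.
split; last by rewrite lerD2r.
split; first exact: prox_off_sparse.
by case: tx => _; exact: le_trans.
Qed.

Lemma line_search_sound x L xp M : 0 < L <= Lmax -> tame x ->
  line_search A b lambda gamma_inc x L xp M ->
  [/\ 0 < M <= Lmax, xp = prox A b lambda M x &
    phi_ xp <= psi A b lambda M x xp].
Proof.
move=> + tx ls; elim: ls => {L xp M} [L acc|L xp M rej _ IH] /andP[L0 Lle].
  by split; rewrite ?L0.
apply: IH; rewrite mulr_gt0 //=; last exact: lt_trans gamma_inc_gt1.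
have L_lt : L < rp.
  rewrite ltNge; apply/negP => rpL; move: rej; rewrite ltNge.
  by rewrite line_search_test_large // rpL.
by rewrite mulrC ler_wpM2l ?(ltW L_lt) // ltW // (lt_trans ltr01).
Qed.

(** Once the trial value reaches [rp] the test succeeds; the last increase
    starts below [rp], hence no trial value exceeds [Lmax]. *)
Lemma line_search_total x L : 0 < L <= Lmax -> tame x ->
  exists xp M, line_search A b lambda gamma_inc x L xp M.
Proof.
case/andP=> L0 Lle tx; have g0 : 0 < gamma_inc by exact: lt_trans gamma_inc_gt1.
have [k] : exists k, rp * gamma_inc^-1 ^+ k <= L.
  apply: geometric_eventually_le => //.
  by rewrite invr_ge0 (ltW g0) invf_lt1.
elim: k L L0 Lle => [|k IH] L L0 Lle.
  rewrite expr0 mulr1 => rpL; exists (prox A b lambda L x), L.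
  by constructor; apply: line_search_test_large; rewrite ?rpL.
rewrite exprSr mulrA ler_pdivrMr // => kL.
have [acc|rej] :=
  leP (phi_ (prox A b lambda L x)) (psi A b lambda L x (prox A b lambda L x)).
  by exists (prox A b lambda L x), L; constructor.
have L_lt : L < rp.
  rewrite ltNge; apply/negP => rpL; move: rej; rewrite ltNge.
  by rewrite line_search_test_large // rpL.
have [|||xp [M ls]] := IH (L * gamma_inc) => //; first by rewrite mulr_gt0.
  by rewrite mulrC ler_wpM2l ?(ltW L_lt) // ltW.
by exists xp, M; exact: LineSearchIncr.
Qed.

Lemma next_trial M : 0 < M <= Lmax -> 0 < Num.max L_min (M / gamma_dec) <= Lmax.
Proof.
case/andP=> M0 Mle; have d0 : 0 < gamma_dec by exact: lt_le_trans gamma_dec_ge1.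
rewrite lt_max divr_gt0 // orbT ge_max L_min_le /=.
apply: le_trans Mle; rewrite ler_pdivrMr //.
by rewrite -[leLHS]mulr1 ler_wpM2l // ltW.
Qed.

Lemma step_estimates x L xp M : 0 < L <= Lmax -> tame x ->
  line_search A b lambda gamma_inc x L xp M ->
  [/\ 0 < M <= Lmax, tame xp, gap xp <= gap x,
      gap xp <= (1 - 1 / (gamma_inc * kappa)) * gap x &
      omega A b lambda xp ^+ 2 <= 2 * Lmax * (1 + kappa) ^+ 2 * gap x].
Proof.
move=> LP tx /(line_search_sound LP tx)[MP -> acc].
have [tp gp] := tame_prox MP tx acc.
split=> //; first exact: gap_contraction.
exact: residue_prox_sqr_le.
Qed.

Let contraction := 1 - 1 / (gamma_inc * kappa).

Lemma contraction_itv : 0 <= contraction < 1.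
Proof.
have gk : 1 < gamma_inc * kappa.
  rewrite -(ltr_pM2r rm_gt0) /kappa -mulrA divfK ?gt_eqF // mul1r.
  exact: le_lt_trans rm_le_rp rp_lt_Lmax.
have gk0 : 0 < gamma_inc * kappa by exact: lt_trans gk.
rewrite /contraction subr_ge0 ltrBlDr ltrDl div1r invr_gt0 gk0 andbT.
by rewrite invf_le1 // ltW.
Qed.

(** The residue of a step that does not stop is controlled by the gap before
    that step, so the count below has an exponent two less than the number of
    steps: the last step is not constrained, and the last but one is governed
    by the gap reached before it. *)
Lemma prox_grad_sound eps x L k xh Mh : 0 < eps -> 0 < L <= Lmax -> tame x ->
  prox_grad A b lambda eps gamma_inc gamma_dec L_min x L k xh Mh ->
  [/\ [/\ 0 < Mh <= Lmax, tame xh & gap xh <= gap x],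
      omega A b lambda xh <= eps, (0 < k)%N &
      (1 < k)%N -> eps ^+ 2 <
        2 * Lmax * (1 + kappa) ^+ 2 * gap x * contraction ^+ (k - 2)].
Proof.
move=> e0 + + pg.
elim: pg => {x L k xh Mh} [x L xp M ls stop|x L xp M k xh Mh ls go _ IH] LP tx.
  by have [MP tp gp _ _] := step_estimates LP tx ls.
have [MP tp gp contr res] := step_estimates LP tx ls.
have [[MhP th gh] stop k0 cnt] := IH (next_trial MP) tp.
split=> //; first by split=> //; exact: le_trans gp.
move=> _; case: k k0 cnt {IH} => [//|[|k]] _ cnt.
  rewrite expr0 mulr1; apply: lt_le_trans res.
  by rewrite ltr_sqr ?nnegrE ?residue_ge0 // ltW.
apply: lt_le_trans (cnt isT) _.
rewrite !subSS !subn0 [contraction ^+ _.+1]exprS [leRHS]mulrA.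
rewrite ler_wpM2r ?exprn_ge0 //.
  by case/andP: contraction_itv.
rewrite -[leRHS]mulrA [gap x * _]mulrC ler_wpM2l //.
have k0 : 0 <= kappa by rewrite divr_ge0 ?ltW.
have Lm0 : 0 <= Lmax by exact: ltW (lt_trans rp_gt0 rp_lt_Lmax).
by rewrite mulr_ge0 ?sqr_ge0 // mulr_ge0.
Qed.

Lemma prox_grad_total eps x L : 0 < eps -> 0 < L <= Lmax -> tame x ->
  exists k xh Mh,
    prox_grad A b lambda eps gamma_inc gamma_dec L_min x L k xh Mh.
Proof.
move=> e0 LP tx.
have c0 : 0 <= 2 * Lmax * (1 + kappa) ^+ 2.
  have Lm0 : 0 <= Lmax by exact: ltW (lt_trans rp_gt0 rp_lt_Lmax).
  by rewrite mulr_ge0 ?sqr_ge0 // mulr_ge0.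
have [j] : exists j, 2 * Lmax * (1 + kappa) ^+ 2 * gap x * contraction ^+ j
    <= eps ^+ 2.
  by apply: geometric_eventually_le; rewrite ?contraction_itv ?exprn_gt0.
elim: j x L LP tx => [|j IH] x L LP tx small;
  have [xp [M ls]] := line_search_total LP tx;
  have [MP tp gp contr res] := step_estimates LP tx ls.
  exists 1%N, xp, M; constructor=> //.
  rewrite -ler_sqr ?nnegrE ?residue_ge0 ?(ltW e0) //; apply: le_trans res _.
  by rewrite -[leLHS]mulr1 -(expr0 contraction).
have [stop|go] := leP (omega A b lambda xp) eps.
  by exists 1%N, xp, M; constructor.
have [|k [xh [Mh pg]]] := IH xp _ (next_trial MP) tp.
  apply: le_trans small; rewrite [contraction ^+ _.+1]exprS [leRHS]mulrA.
  rewrite ler_wpM2r ?exprn_ge0 //.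
    by case/andP: contraction_itv.
  by rewrite -[leRHS]mulrA [gap x * _]mulrC ler_wpM2l.
by exists k.+1, xh, Mh; exact: ProxGradNext ls go pg.
Qed.

(** * One stage of the homotopy *)

Definition warm_start x : Prop :=
  sparse_off xbar st x /\ omega A b lambda x <= delta' * lambda.

Lemma tame_of_warm x : warm_start x -> tame x.
Proof.
by case=> sx wx; split=> //; exact: (phi_start hb rho_gt0 regime sx wx).
Qed.

Lemma warm_xs : warm_start xs.
Proof.
split=> //; rewrite residue_xs mulr_ge0 ?(ltW lambda_gt0) //.
by apply: ltW; case: regime.
Qed.

Lemma warm_gap_le_residue x : warm_start x ->
  lambda * gap x <= omega A b lambda x * (4 * (1 + gamma) * w).
Proof.
case=> sx wx.
have [le1 _] := err_bounds hb rho_gt0 regime sx wx.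
have [_ ws] := warm_xs.
have [le1s _] := err_bounds hb rho_gt0 regime sparse_xs ws.
have dist : lambda * norm1 (x - xs) <= 4 * (1 + gamma) * w.
  have -> : x - xs = (x - xbar) + - (xs - xbar).
    by rewrite opprB addrA subrK.
  have := ler_wpM2l (ltW lambda_gt0) (norm1D (x - xbar) (- (xs - xbar))).
  by rewrite norm1N -/w; move: le1 le1s; rewrite -/w; lra.
have := ler_wpM2l (ltW lambda_gt0) (phi_gap_le_residue A b x xs lambda_gt0).
rewrite -/(gap x) => /le_trans; apply; rewrite mulrCA ler_wpM2l //.
exact: residue_ge0.
Qed.

(** Comparing both points with [xbar] gives half of what the residue bound
    yields with [delta'] replaced by 1. *)
Lemma warm_gap_le x : warm_start x -> gap x <= 2 * (1 + gamma) * w.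
Proof.
move=> /tame_of_warm[sx phix].
have := phi_xbar_le hb rho_gt0 regime sparse_xs.
have := excess_le rho_gt0 regime.
have := err_scale_ge0 lambda rho_gt0.
by move: phix; rewrite /gap -/w -/phi_; lra.
Qed.

(** If the residue of [xh] exceeds [delta' * lambda], so does [eps]; the
    starting point is then already accurate enough, and the gap has not
    increased. *)
Lemma final_gap_le eps x xh : warm_start x -> sparse_off xbar st xh ->
  gap xh <= gap x -> omega A b lambda xh <= eps ->
  lambda * gap xh <= eps * (4 * (1 + gamma) * w).
Proof.
move=> wx sxh le_gap res.
have gw0 : 0 <= 4 * (1 + gamma) * w.
  rewrite mulr_ge0 ?(err_scale_ge0 lambda rho_gt0) //.
  by have [g0 _ _ _ _ _] := regime; lra.
have [small|large] := leP (omega A b lambda xh) (delta' * lambda).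
  apply: le_trans (warm_gap_le_residue _) _; first by split.
  by rewrite ler_wpM2r.
apply: le_trans (ler_wpM2l (ltW lambda_gt0) le_gap) _.
apply: le_trans (warm_gap_le_residue wx) _; rewrite ler_wpM2r //.
by have [_ /le_trans] := wx; apply; exact/ltW/(lt_le_trans large).
Qed.

Lemma warm_steps eps x L k xh Mh (C := 8 * gamma_inc * (1 + kappa) ^+ 2
    * (1 + gamma) * kappa * sbar%:R) :
  0 < eps -> 0 < L <= Lmax -> warm_start x ->
  prox_grad A b lambda eps gamma_inc gamma_dec L_min x L k xh Mh ->
  (1 < k)%N ->
  eps ^+ 2 < C * lambda ^+ 2 / 2 * (1 - 1 / (gamma_inc * kappa)) ^+ (k - 2).
Proof.
move=> e0 LP wx pg k1.
have [_ _ _ /(_ k1)/lt_le_trans] := prox_grad_sound e0 LP (tame_of_warm wx) pg.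
apply; have /andP[q0 _] := contraction_itv; rewrite ler_wpM2r ?exprn_ge0 //.
have c0 : 0 <= 2 * Lmax * (1 + kappa) ^+ 2.
  have Lm0 : 0 <= Lmax by exact: ltW (lt_trans rp_gt0 rp_lt_Lmax).
  by rewrite mulr_ge0 ?sqr_ge0 // mulr_ge0.
have g0 : 0 <= 2 * (1 + gamma) by have [g0 _ _ _ _ _] := regime; lra.
have w_le : w <= lambda ^+ 2 * sbar%:R / rm.
  rewrite /w /err_scale ler_wpM2l ?mulr_ge0 ?exprn_ge0 ?(ltW lambda_gt0) //.
  by rewrite lef_pV2.
apply: le_trans (ler_wpM2l c0 (warm_gap_le wx)) _.
apply: le_trans (ler_wpM2l c0 (ler_wpM2l g0 w_le)) _.
rewrite le_eqVlt; apply/orP; left; apply/eqP.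
by rewrite /C /Lmax /kappa; field; rewrite gt_eqF.
Qed.
End WithMinimizer.

Lemma stage_call eps x L (C := 8 * gamma_inc * (1 + kappa) ^+ 2
    * (1 + gamma) * kappa * sbar%:R) :
  0 < eps -> 0 < L <= Lmax -> warm_start x ->
  (exists k xh Mh,
     prox_grad A b lambda eps gamma_inc gamma_dec L_min x L k xh Mh) /\
  forall k xh Mh,
  prox_grad A b lambda eps gamma_inc gamma_dec L_min x L k xh Mh ->
  [/\ sparse_off xbar st xh /\ 0 < Mh <= Lmax,
      omega A b lambda xh <= eps,
      lambda * (phi A b lambda xh - phi_star A b lambda)
        <= eps * (4 * (1 + gamma) * w) &
      (1 < k)%N -> eps ^+ 2 <
        C * lambda ^+ 2 / 2 * (1 - 1 / (gamma_inc * kappa)) ^+ (k - 2)].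
Proof.
move=> e0 LP wx; have tx := tame_of_warm wx.
have [xs sxs rxs] := sparse_minimizer.
split=> [|k xh Mh pg]; first exact: prox_grad_total sxs rxs _ _ _ e0 LP tx.
have [[MP [sxh _] le_gap] res _ _] := prox_grad_sound sxs rxs e0 LP tx pg.
have min_xs y : phi_ xs <= phi_ y by exact: residue0_min.
have count := warm_steps sxs rxs e0 LP wx pg.
split=> //.
rewrite (phi_starE min_xs); exact: final_gap_le sxs rxs _ _ _ wx sxh le_gap res.
Qed.

End ProxGradAnalysis.

(** * From contraction factors to step counts *)

Section StepCounts.
Variables (R : realType) (q : R).
Implicit Types (k : nat) (D e : R).
Hypothesis q_gt1 : 1 < q.

Let r := 1 - 1 / (4 * q).
Let c := 1 - 1 / q.

Let inv_q : 0 < q^-1 < 1.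
Proof. by rewrite invr_gt0 invf_lt1 ?q_gt1 ?(lt_trans ltr01 q_gt1). Qed.

Let rE : r = 1 - q^-1 / 4.
Proof. by rewrite /r; have := q_gt1 => q1; field; lra. Qed.

Lemma rate_gt0 : 0 < ln r^-1.
Proof.
have /andP[u0 u1] := inv_q; apply: ln_gt0; rewrite invf_gt1 rE; lra.
Qed.

Lemma steps_le_ln k D : 1 <= D * r ^+ k -> k%:R <= ln D / ln r^-1.
Proof.
have /andP[u0 u1] := inv_q; have r0 : 0 < r by rewrite rE; lra.
move=> Dr; have rk0 : 0 < r ^+ k by rewrite exprn_gt0.
have D0 : 0 < D by rewrite -(pmulr_lgt0 _ rk0); lra.
rewrite ler_pdivlMr ?rate_gt0 // mulr_natl -lnXn ?invr_gt0 //.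
rewrite ler_ln ?posrE ?exprn_gt0 ?invr_gt0 // exprVn.
by rewrite -[leLHS]mul1r ler_pdivrMr.
Qed.

(** The factor 1/2 pays for the two steps missing from the exponent, as
    [r >= 3/4]. *)
Lemma half_contraction_le k : (1 < k)%N -> c ^+ (k - 2) / 2 <= r ^+ k.
Proof.
have /andP[u0 u1] := inv_q; case: k => [//|[//|k]] _.
rewrite !subSS subn0 -(addn2 k) exprD; apply: ler_pM; rewrite ?invr_ge0 //.
- by rewrite exprn_ge0 // /c div1r; lra.
- by rewrite lerXn2r ?nnegrE ?rE /c ?div1r //; lra.
- rewrite rE; nra.
Qed.

(** As soon as the contraction enters, its comparison with the fourth power of
    [r] saves one step more. *)
Lemma half_contraction_le_succ k : (2 < k)%N -> c ^+ (k - 2) / 2 <= r ^+ k.+1.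
Proof.
have /andP[u0 u1] := inv_q; case: k => [//|[//|[//|k]]] _.
have c0 : 0 <= c by rewrite /c div1r; lra.
rewrite !subSS subn0 exprSr -mulrA.
have -> : k.+4 = (k + 4)%N by rewrite addn4.
rewrite exprD; apply: ler_pM; rewrite ?exprn_ge0 ?mulr_ge0 //.
- by rewrite lerXn2r ?nnegrE ?rE /c ?div1r //; lra.
- rewrite rE /c div1r; have [u uE] : exists u, u = q^-1 by exists q^-1.
  rewrite -uE in u0 u1 *.
  have -> : (1 - u / 4) ^+ 4 = ((1 - u / 4) ^+ 2) ^+ 2 by rewrite -exprM.
  have h : 0 <= 1 - u / 2 <= (1 - u / 4) ^+ 2.
    by have := sqr_ge0 u; rewrite sqrrB; lra.
  have : (1 - u / 2) ^+ 2 <= ((1 - u / 4) ^+ 2) ^+ 2.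
    by have /andP[h1 h2] := h; rewrite ler_sqr ?nnegrE // sqr_ge0.
  by have := sqr_ge0 u; rewrite sqrrB; lra.
Qed.

Lemma steps_le k D e : 0 < e -> (1 < k)%N -> e < D / 2 * c ^+ (k - 2) ->
  0 <= D -> k%:R <= ln (D / e) / ln r^-1.
Proof.
move=> e0 k1 lt_e D0; apply: steps_le_ln.
rewrite mulrAC ler_pdivlMr // mul1r; apply: le_trans (ltW lt_e) _.
by rewrite -mulrA ler_wpM2l // mulrC half_contraction_le.
Qed.

Lemma steps_succ_le k D e : 0 < e -> 0 <= D -> 64 * e <= D ->
  ((1 < k)%N -> e < D / 2 * c ^+ (k - 2)) ->
  k.+1%:R <= ln (D / e) / ln r^-1.
Proof.
have /andP[u0 u1] := inv_q; have r0 : 0 < r by rewrite rE; lra.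
have r1 : r <= 1 by rewrite rE; lra.
move=> e0 D0 De cnt; apply: steps_le_ln.
rewrite mulrAC ler_pdivlMr // mul1r.
have [k2|k2] := leqP k 2.
  have r3 : 1 / 64 <= r ^+ 3.
    have : (1 / 4) ^+ 3 <= r ^+ 3 by rewrite ler_pXn2r ?nnegrE ?rE //; lra.
    by rewrite !exprS expr0; lra.
  have rk : r ^+ 3 <= r ^+ k.+1 by rewrite ler_wiXn2l // ltW.
  by apply: le_trans (ler_pM _ _ De (le_trans r3 rk)); lra.
apply: le_trans (ltW (cnt (ltnW k2))) _.
by rewrite -mulrA ler_wpM2l // mulrC half_contraction_le_succ.
Qed.

End StepCounts.

(** * The sequence of regularization parameters *)

Section Schedule.
Variables (R : realType) (m n : nat) (A : 'M[R]_(m, n)) (b : 'cV[R]_m).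
Variables (lambda_tgt eta : R).
Hypothesis tgt_gt0 : 0 < lambda_tgt.
Hypothesis tgt_le : lambda_tgt <= lambda0 A b.
Hypothesis eta_itv : 0 < eta < 1.

Let l0 := lambda0 A b.
Let N := num_stages A b eta lambda_tgt.

Lemma lambdaE K : lambda_ A b eta K = eta ^+ K * l0.
Proof. by elim: K => [|K IH]; rewrite ?mul1r //= IH mulrA -exprS. Qed.

Let l0_gt0 : 0 < l0. Proof. exact: lt_le_trans tgt_le. Qed.
Let eta_gt0 : 0 < eta. Proof. by case/andP: eta_itv. Qed.
Let ln_eta_gt0 : 0 < ln eta^-1.
Proof. by case/andP: eta_itv => ? ?; rewrite ln_gt0 // invf_gt1. Qed.
Let ratio_gt0 : 0 < l0 / lambda_tgt. Proof. exact: divr_gt0. Qed.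

Lemma ln_ratio_ge0 : 0 <= ln (l0 / lambda_tgt).
Proof. by rewrite ln_ge0 // ler_pdivlMr // mul1r. Qed.

Lemma num_stages_le : N%:R <= ln (l0 / lambda_tgt) / ln eta^-1.
Proof. by rewrite /N /num_stages truncn_le divr_ge0 ?ln_ratio_ge0 // ltW. Qed.

Lemma lambda_gt0 K : 0 < lambda_ A b eta K.
Proof. by rewrite lambdaE mulr_gt0 // exprn_gt0. Qed.

Lemma lambda_ge_tgt K : (K <= N)%N -> lambda_tgt <= lambda_ A b eta K.
Proof.
rewrite -(ler_nat R) => /le_trans/(_ num_stages_le).
rewrite ler_pdivlMr // mulr_natl -lnXn ?invr_gt0 //.
rewrite ler_ln ?posrE ?exprn_gt0 ?invr_gt0 // exprVn lambdaE.
by rewrite ler_pdivlMr // mulrC ler_pdivrMr ?exprn_gt0 // mulrC.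
Qed.

Lemma eta_lambda_lt_tgt : eta * lambda_ A b eta N < lambda_tgt.
Proof.
have : ln (l0 / lambda_tgt) / ln eta^-1 < N.+1%:R by exact: truncnS_gt.
rewrite ltr_pdivrMr // mulr_natl -lnXn ?invr_gt0 //.
rewrite ltr_ln ?posrE ?exprn_gt0 ?invr_gt0 // exprVn lambdaE.
by rewrite ltr_pdivrMr // ltr_pdivlMl ?exprn_gt0 // exprS mulrA.
Qed.

(** [A^T b / lambda0] is a subgradient of the l1 norm at zero. *)
Lemma residue_lambda0 : omega A b l0 0 <= 0.
Proof.
pose xi := l0^-1 *: (A^T *m b).
have sub : subdiff (@norm1 R n) 0 xi.
  apply/subdiff_norm1P => j.
  rewrite [X in _ * X]mxE [X in `|X| <= _]mxE [X in _ = `|X|]mxE.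
  rewrite mulr0 normr0; split=> //.
  rewrite normrM normfV (gtr0_norm l0_gt0) ler_pdivrMl // mulr1.
  exact: entry_le_norm.
apply: le_trans (residue_le_norm _ _ _ sub) _.
rewrite /grad_lsq mulmx0 sub0r mulmxN /xi scalerA divff ?gt_eqF //.
by rewrite scale1r addNr normr0.
Qed.

End Schedule.

(** * The homotopy method *)

Section Homotopy.
Variables (R : realType) (m n : nat) (A : 'M[R]_(m, n)) (b z : 'cV[R]_m).
Variables (xbar : 'cV[R]_n) (st : nat).
Variables (gamma delta' lambda_tgt gamma_inc gamma_dec L_min eps delta eta : R).

Let sbar := norm0 xbar.
Let noise := `|A^T *m z|.
Let rho := rho_minus A (sbar + st).
Let rm := rho_minus A (sbar + 2 * st).
Let rp := rho_plus A (sbar + 2 * st).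
Let kappa := rp / rm.
Let Lmax := gamma_inc * rp.
Let N := num_stages A b eta lambda_tgt.
Let lam := lambda_ A b eta.

Hypothesis hb : b = A *m xbar + z.
Hypothesis hgamma_inc : 1 < gamma_inc.
Hypothesis hgamma_dec : 1 <= gamma_dec.
Hypothesis hlambda_tgt : 0 < lambda_tgt.
Hypothesis hgamma : 0 < gamma.
Hypothesis hdelta' : 0 < delta' < 1.
Hypothesis hgamma_delta' : (1 + delta') / (1 - delta') < gamma.
Hypothesis hnoise :
  Num.max 4 ((gamma + 1) / ((1 - delta') * gamma - (1 + delta'))) * noise
    <= lambda_tgt.
Hypothesis hrho : 0 < rm.
Hypothesis hst :
  16 * (Lmax + 2 * rho_plus A st) / rho * (1 + gamma) * sbar%:R < st%:R.
Hypothesis hL_min : 0 < L_min <= Lmax.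
Hypothesis hlambda0 : lambda_tgt <= lambda0 A b.
Hypothesis heps : 0 < eps.
Hypothesis hdelta : 0 < delta < 1.
Hypothesis heta : 0 < eta < 1.
Hypothesis hdelta_eta : (1 + delta) / (1 + delta') <= eta.

(** If [xbar] were zero, [b] would be pure noise and the noise condition would
    contradict [lambda_tgt <= lambda0]. *)
Lemma support_nonempty : exists j : 'I_n, j \in supp xbar.
Proof.
apply/set0Pn/negP => /eqP s0.
have x0 : xbar = 0.
  apply/colP => j; rewrite mxE; apply/eqP.
  by have /setP/(_ j) := s0; rewrite !inE => /negbFE.
have := hlambda0; rewrite /lambda0 hb x0 mulmx0 add0r -/noise => le_noise.
have n0 : 0 < noise by exact: lt_le_trans le_noise.
have : 4 * noise <= lambda_tgt.
  by apply: le_trans hnoise; rewrite ler_wpM2r ?(ltW n0) // le_max lexx.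
lra.
Qed.

Let sbar_gt0 : (0 < sbar)%N.
Proof. by apply/card_gt0P; have [j] := support_nonempty; exists j. Qed.

Let size_gt0 : (0 < sbar + 2 * st)%N.
Proof. by rewrite addn_gt0 sbar_gt0. Qed.

Let rm_le_rho : rm <= rho.
Proof.
have [j _] := support_nonempty; apply: rho_minus_anti => //.
by rewrite addn_gt0 sbar_gt0 leq_add2l mul2n -addnn leq_addr.
Qed.

Let rm_le_rp : rm <= rp.
Proof. by have [j _] := support_nonempty; exact: rho_minus_le_plus. Qed.

Let rho_gt0 : 0 < rho. Proof. exact: lt_le_trans rm_le_rho. Qed.

Lemma regime_above lambda : lambda_tgt <= lambda ->
  lasso_regime gamma delta' noise lambda.
Proof.
move=> le_l; have /andP[d0 d1] := hdelta'; have t0 := hlambda_tgt.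
have slope : 0 < (1 - delta') * gamma - (1 + delta').
  by have := hgamma_delta'; rewrite ltr_pdivrMr; lra.
have n0 : 0 <= noise by exact: normr_ge0.
have := le_trans hnoise le_l => le_max_l.
split=> //; first lra.
  by apply: le_trans le_max_l; rewrite ler_wpM2r // le_max lexx.
rewrite -ler_pdivrMl // mulrA [_^-1 * _]mulrC; apply: le_trans le_max_l.
by rewrite ler_wpM2r // le_max lexx orbT.
Qed.

Let lam_gt0 K : 0 < lam K.
Proof. exact: lambda_gt0 hlambda_tgt hlambda0 heta K. Qed.

Definition stage_state K x M : Prop :=
  [/\ sparse_off xbar st x, omega A b (lam K) x <= delta * lam K &
      0 < M <= Lmax].

(** Decreasing [lambda] by a factor at least [eta] raises the residue by at most
    the decrease of [lambda]; the choice of [eta] turns the final accuracy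
    [delta] of one stage into the initial accuracy [delta'] of the next. *)
Lemma stage_warm K x M lambda : stage_state K x M ->
  0 < lambda -> eta * lam K <= lambda <= lam K ->
  warm_start A b xbar st delta' lambda x.
Proof.
case=> sx wx _ l0 /andP[lo hi]; split=> //.
have l0hi : 0 < lambda <= lam K by rewrite l0.
apply: le_trans (residue_decrease_lambda _ _ _ l0hi) _.
have /andP[d0 d1] := hdelta'; have lK : 0 < lam K by exact: lt_le_trans hi.
have : (1 + delta) * lam K <= (1 + delta') * lambda.
  have d1' : 0 < 1 + delta' by lra.
  rewrite -ler_pdivrMl // mulrA [_^-1 * _]mulrC.
  by apply: le_trans lo; rewrite ler_wpM2r // ltW.
lra.
Qed.

Lemma stage_state0 : stage_state 0 0 L_min.
Proof.
have /andP[d0 _] := hdelta.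
split=> //; first by rewrite /sparse_off supp0 finset.set0D cards0.
apply: le_trans (residue_lambda0 hlambda_tgt hlambda0) _.
by rewrite mulr_ge0 ?(ltW d0) ?(ltW (lam_gt0 0)).
Qed.

Lemma stage_warm_next K x M : (K < N)%N -> stage_state K x M ->
  warm_start A b xbar st delta' (lam K.+1) x.
Proof.
move=> KN sK; have lK1 : 0 < lam K.+1 by exact: lam_gt0.
apply: stage_warm sK lK1 _; rewrite lexx /=.
have lK : 0 < lam K by exact: lam_gt0.
have /andP[_ e1] := heta.
by rewrite -[leRHS]mul1r ler_wpM2r ?ltW.
Qed.

Lemma stage_warm_tgt x M : stage_state N x M ->
  warm_start A b xbar st delta' lambda_tgt x.
Proof.
move=> sN; apply: stage_warm sN hlambda_tgt _.
rewrite (lambda_ge_tgt hlambda_tgt hlambda0 heta) // andbT ltW //.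
exact: eta_lambda_lt_tgt.
Qed.

Let lam_ge_tgt K : (K < N)%N -> lambda_tgt <= lam K.+1.
Proof. exact: (lambda_ge_tgt hlambda_tgt hlambda0 heta). Qed.

Let L_min_le : L_min <= Lmax. Proof. by case/andP: hL_min. Qed.

Let C := 8 * gamma_inc * (1 + kappa) ^+ 2 * (1 + gamma) * kappa * sbar%:R.
Let rate := ln (1 - 1 / (4 * gamma_inc * kappa))^-1.

Let call lambda (le_l : lambda_tgt <= lambda) := stage_call hb
  (regime_above le_l) hrho rm_le_rho rm_le_rp size_gt0 hgamma_inc hgamma_dec
  L_min_le hst.

Let delta_lam_gt0 K : 0 < delta * lam K.
Proof. by have /andP[d0 _] := hdelta; rewrite mulr_gt0. Qed.

Lemma stage_state_next K x M k xh Mh : (K < N)%N -> stage_state K x M ->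
  prox_grad A b (lam K.+1) (delta * lam K.+1) gamma_inc gamma_dec L_min
    x M k xh Mh -> stage_state K.+1 xh Mh.
Proof.
move=> KN sK; have [_ _ MP] := sK.
have [_ sound] :=
  call (lam_ge_tgt KN) (delta_lam_gt0 K.+1) MP (stage_warm_next KN sK).
by move=> /sound[[]].
Qed.

Lemma stage_states (x_ : nat -> 'cV[R]_n) (M_ : nat -> R) (k_ : nat -> nat) l :
  (l <= N)%N -> x_ 0 = 0 -> M_ 0 = L_min ->
  (forall K, (K < l)%N ->
    prox_grad A b (lam K.+1) (delta * lam K.+1) gamma_inc gamma_dec L_min
      (x_ K) (M_ K) (k_ K) (x_ K.+1) (M_ K.+1)) ->
  forall K, (K <= l)%N -> stage_state K (x_ K) (M_ K).
Proof.
move=> lN x0 M0 run; elim=> [|K IH] Kl.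
  by rewrite x0 M0; exact: stage_state0.
exact: (stage_state_next (leq_trans Kl lN) (IH (ltnW Kl)) (run K Kl)).
Qed.

Lemma stages_exist l : (l <= N)%N ->
  exists (x_ : nat -> 'cV[R]_n) (M_ : nat -> R) (k_ : nat -> nat),
  [/\ x_ 0 = 0, M_ 0 = L_min & forall K, (K < l)%N ->
    prox_grad A b (lam K.+1) (delta * lam K.+1) gamma_inc gamma_dec L_min
      (x_ K) (M_ K) (k_ K) (x_ K.+1) (M_ K.+1)].
Proof.
elim: l => [|l IH] lN; first by exists (fun=> 0), (fun=> L_min), (fun=> 0%N).
have [x_ [M_ [k_ [x0 M0 run]]]] := IH (ltnW lN).
have sl := stage_states (ltnW lN) x0 M0 run (leqnn l).
have [_ _ MP] := sl.
have [[k [xh [Mh pg]]] _] :=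
  call (lam_ge_tgt lN) (delta_lam_gt0 l.+1) MP (stage_warm_next lN sl).
exists (fun i => if (i <= l)%N then x_ i else xh),
  (fun i => if (i <= l)%N then M_ i else Mh),
  (fun i => if (i < l)%N then k_ i else k).
split=> // K; rewrite ltnS leq_eqVlt => /predU1P[->|Kl].
  by rewrite eqxx ltnn.
by rewrite Kl orbT; exact: run.
Qed.

Lemma homotopy_terminates : exists t,
  homotopy_run A b lambda_tgt eps L_min gamma_inc gamma_dec eta delta t.
Proof.
have [x_ [M_ [k_ [x0 M0 run]]]] := stages_exist (leqnn N).
have sN := stage_states (leqnn N) x0 M0 run (leqnn N).
have [_ _ MP] := sN.
have [[k [xh [Mh pg]]] _] := call (lexx _) heps MP (stage_warm_tgt sN).
by exists (HomotopyTrace x_ M_ k_ xh Mh k); split.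
Qed.

Let q_gt1 : 1 < gamma_inc * kappa.
Proof.
rewrite -(ltr_pM2r hrho) /kappa -mulrA divfK ?gt_eqF // mul1r.
have rp0 : 0 < rp by exact: lt_le_trans rm_le_rp.
by apply: le_lt_trans rm_le_rp _; rewrite ltr_pMl.
Qed.

Let rateE : ln (1 - 1 / (4 * (gamma_inc * kappa)))^-1 = rate.
Proof. by rewrite mulrA. Qed.

Let C_ge64 : 64 <= C.
Proof.
have k1 : 1 <= kappa by rewrite ler_pdivlMr // mul1r.
have s1 : 1 <= sbar%:R :> R by rewrite ler1n.
have g1 : 2 <= 1 + gamma.
  by have := gamma_gt1 (regime_above (lexx _)); lra.
have i1 := hgamma_inc.
have k4 : 4 <= (1 + kappa) ^+ 2 by rewrite sqrrD; nra.
have -> : C =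
    8 * gamma_inc * ((1 + kappa) ^+ 2 * (1 + gamma)) * (kappa * sbar%:R).
  by rewrite /C !mulrA.
have kg : 4 * 2 <= (1 + kappa) ^+ 2 * (1 + gamma) by apply: ler_pM.
have ks : 1 * 1 <= kappa * sbar%:R by apply: ler_pM.
have i8 : 8 * 1 <= 8 * gamma_inc by lra.
have ikg := ler_pM _ _ i8 kg; have all := ler_pM _ _ (ikg _ _) ks.
by apply: le_trans (all _ _ _ _); lra.
Qed.

Lemma stage_steps_le K x M k xh Mh : (K < N)%N -> stage_state K x M ->
  prox_grad A b (lam K.+1) (delta * lam K.+1) gamma_inc gamma_dec L_min
    x M k xh Mh -> k.+1%:R <= ln (C / delta ^+ 2) / rate.
Proof.
move=> KN sK; have [_ _ MP] := sK.
have [_ sound] :=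
  call (lam_ge_tgt KN) (delta_lam_gt0 K.+1) MP (stage_warm_next KN sK).
move=> /sound[_ _ _ count]; have /andP[d0 d1] := hdelta.
have lK : 0 < lam K.+1 by exact: lam_gt0.
rewrite -rateE; apply: steps_succ_le => //; rewrite ?exprn_gt0 //.
- by apply: le_trans C_ge64; lra.
- apply: le_trans C_ge64; rewrite -[leRHS]mulr1 ler_wpM2l //.
  by rewrite exprn_ile1 // ltW.
move=> k1; rewrite -(ltr_pM2r (exprn_gt0 2 lK)) -exprMn.
by move: (count k1); rewrite -/C; congr (_ < _); ring.
Qed.

Lemma final_steps_le x M k xh Mh : stage_state N x M ->
  prox_grad A b lambda_tgt eps gamma_inc gamma_dec L_min x M k xh Mh ->
  (1 < k)%N -> k%:R <= ln (lambda_tgt ^+ 2 * C / eps ^+ 2) / rate.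
Proof.
move=> sN; have [_ _ MP] := sN.
have [_ sound] := call (lexx _) heps MP (stage_warm_tgt sN).
move=> /sound[_ _ _ count] k1; rewrite -rateE; apply: steps_le => //.
- by rewrite exprn_gt0.
- by rewrite [_ ^+ 2 * C]mulrC; exact: count.
- by rewrite mulr_ge0 ?sqr_ge0 //; apply: le_trans C_ge64; lra.
Qed.

(** The bound combines the residue of [x] at [lambda_tgt] with the l1 errors at
    the two parameters, [(2 l - t) (l + t)] being at most [9/4 l^2]. *)
Lemma stage_gap_le K x M : (K < N)%N -> stage_state K x M ->
  phi A b lambda_tgt x - phi_star A b lambda_tgt <=
  eta ^+ (2 * K.+1)
    * ((9 / 2) * (1 + gamma) * lambda0 A b ^+ 2 * sbar%:R / rho).
Proof.
move=> KN /(stage_warm_next KN)[sx wx].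
have reg := regime_above (lam_ge_tgt KN); have regt := regime_above (lexx _).
have t0 := hlambda_tgt; have tl := lam_ge_tgt KN.
have l0 : 0 < lam K.+1 by exact: lt_le_trans tl.
have [xs sxs rxs] :=
  sparse_minimizer hb regt hrho rm_le_rho rm_le_rp hgamma_inc hst.
have min_xs y : phi A b lambda_tgt xs <= phi A b lambda_tgt y.
  exact: residue0_min.
have /andP[d0 d1] := hdelta'.
have wxs : omega A b lambda_tgt xs <= delta' * lambda_tgt.
  by rewrite rxs mulr_ge0 // ltW.
have [+ _] := err_bounds hb rho_gt0 reg sx wx.
have [+ _] := err_bounds hb rho_gt0 regt sxs wxs.
rewrite (phi_starE min_xs) mulnC exprM; rewrite /err_scale.
have -> : eta ^+ K.+1 ^+ 2
    * (9 / 2 * (1 + gamma) * lambda0 A b ^+ 2 * sbar%:R / rho)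
  = 9 / 4 * lam K.+1 ^+ 2 * (2 * (1 + gamma) * sbar%:R / rho).
  by rewrite /lam lambdaE; field; rewrite gt_eqF.
set l := lam K.+1 in tl l0 wx *; set t := lambda_tgt in tl t0 *.
set h := 2 * (1 + gamma) * sbar%:R / rho.
have h0 : 0 <= h.
  by rewrite divr_ge0 ?(ltW rho_gt0) // mulr_ge0 //; have := hgamma; lra.
have hE u : 2 * (1 + gamma) * (u ^+ 2 * sbar%:R / rho) = u * (u * h).
  by rewrite /h; field; rewrite gt_eqF.
rewrite !hE !ler_pM2l // => es ex.
have dist : norm1 (x - xs) <= (l + t) * h.
  have -> : x - xs = (x - xbar) + - (xs - xbar) by rewrite opprB addrA subrK.
  by apply: le_trans (norm1D _ _) _; rewrite norm1N; lra.
have tl' : 0 < t <= l by rewrite t0.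
have res : omega A b t x <= 2 * l - t.
  have := residue_decrease_lambda A b x tl'.
  by have := ler_wpM2r (ltW l0) (ltW d1); lra.
apply: le_trans (phi_gap_le_residue A b x xs t0) _.
apply: le_trans (ler_pM (residue_ge0 _ _ _ t0) (norm1_ge0 _) res dist) _.
rewrite mulrA ler_wpM2r //; have := sqr_ge0 (l / 2 - t); lra.
Qed.

Lemma stage_error_le K x M : (K < N)%N -> stage_state K x M ->
  norm2 (x - xbar) <= eta ^+ K.+1 * (2 * lambda0 A b * Num.sqrt sbar%:R / rho).
Proof.
move=> KN /(stage_warm_next KN)[sx wx].
have [_] := err_bounds hb rho_gt0 (regime_above (lam_ge_tgt KN)) sx wx.
congr (_ <= _); rewrite /lam lambdaE; field.
by rewrite gt_eqF.
Qed.

Lemma final_gap_bound x M k xh Mh : stage_state N x M ->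
  prox_grad A b lambda_tgt eps gamma_inc gamma_dec L_min x M k xh Mh ->
  phi A b lambda_tgt xh - phi_star A b lambda_tgt <=
  4 * (1 + gamma) * lambda_tgt * sbar%:R / rho * eps.
Proof.
move=> sN; have [_ _ MP] := sN.
have [_ sound] := call (lexx _) heps MP (stage_warm_tgt sN).
move=> /sound[_ _ le_gap _]; rewrite -(ler_pM2l hlambda_tgt).
by move: le_gap; congr (_ <= _); rewrite /err_scale; field; rewrite gt_eqF.
Qed.

Section Run.
Variable t : homotopy_trace R n.
Hypothesis run :
  homotopy_run A b lambda_tgt eps L_min gamma_inc gamma_dec eta delta t.

Lemma run_state K : (K <= N)%N -> stage_state K (hx t K) (hM t K).
Proof. by case: run => x0 M0 st_ _; exact: stage_states st_ K. Qed.

Lemma run_stage_steps K : (K < N)%N ->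
  (hsteps t K).+1%:R <= ln (C / delta ^+ 2) / rate.
Proof.
by move=> KN; exact: stage_steps_le (run_state (ltnW KN)) (hrun_stage run KN).
Qed.

(** The final call takes one step or satisfies its own bound; when it takes one
    step, the step is charged to the first stage. *)
Lemma run_total_steps : (total_steps t N)%:R <= Num.max 1
  ((ln (lambda0 A b / lambda_tgt) / ln eta^-1 * ln (C / delta ^+ 2)
    + ln (Num.max 1 (lambda_tgt ^+ 2 * C / eps ^+ 2))) / rate).
Proof.
have r0 : 0 < rate by rewrite -rateE rate_gt0.
set F := ln (Num.max 1 _); set c1 := ln (C / _).
have F0 : 0 <= F by rewrite ln_ge0 // le_max lexx.
have Fr0 : 0 <= F / rate by rewrite divr_ge0 // ltW.
have fin_le : (1 < hsteps_tgt t)%N -> (hsteps_tgt t)%:R <= F / rate.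
  have C0 : 0 < C by apply: lt_le_trans C_ge64; lra.
  have D0 : 0 < lambda_tgt ^+ 2 * C / eps ^+ 2.
    exact: divr_gt0 (mulr_gt0 (exprn_gt0 2 hlambda_tgt) C0) (exprn_gt0 2 heps).
  move=> /(final_steps_le (run_state (leqnn N)) (hrun_final run))/le_trans.
  apply; rewrite ler_pM2r ?invr_gt0 // ler_ln ?posrE ?lt_max ?ltr01 //.
  by rewrite le_max lexx orbT.
have sum_le : (\sum_(K < N) hsteps t K)%:R + N%:R <= N%:R * (c1 / rate).
  have sumc (a : R) : N%:R * a = \sum_(K < N) a.
    by rewrite sumr_const card_ord mulr_natl.
  rewrite sumc -[N%:R]mulr1 sumc natr_sum -big_split; apply: ler_sum => K _.
  by rewrite /= natr1; exact: run_stage_steps.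
have [N0|N0] := posnP N.
  rewrite /total_steps N0 big_ord0 add0n.
  have [k1|k1] := leqP (hsteps_tgt t) 1; first by rewrite le_max lern1 k1.
  rewrite le_max; apply/orP; right; apply: le_trans (fin_le k1) _.
  rewrite ler_wpM2r ?invr_ge0 ?(ltW r0) // lerDr mulr_ge0 //.
    by apply: le_trans (num_stages_le _ _ _); rewrite // ler0n.
  rewrite ln_ge0 // ler_pdivlMr ?exprn_gt0; have /andP[d0 d1] := hdelta => //.
  rewrite mul1r; apply: le_trans (exprn_ile1 _ (ltW d0) (ltW d1)) _.
  by apply: le_trans C_ge64; lra.
rewrite le_max; apply/orP; right; rewrite /total_steps natrD.
have fin_le' : (hsteps_tgt t)%:R <= N%:R + F / rate.
  have N1 : 1 <= N%:R :> R by rewrite ler1n.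
  have [k1|/fin_le] := leqP (hsteps_tgt t) 1; last lra.
  have : (hsteps_tgt t)%:R <= 1 :> R by rewrite lern1.
  lra.
have c10 : 0 <= c1 / rate.
  by apply: le_trans (run_stage_steps N0); rewrite ler0n.
have := ler_wpM2r c10 (num_stages_le hlambda_tgt hlambda0 heta).
rewrite -/N mulrDl -[_ * c1 / rate]mulrA; lra.
Qed.

End Run.

End Homotopy.

Theorem theorem2 (R : realType) (m n : nat) (A : 'M[R]_(m, n))
    (b z : 'cV[R]_m) (xbar : 'cV[R]_n)
    (gamma delta' lambda_tgt gamma_inc gamma_dec L_min : R) (st : nat)
    (eps delta eta : R)
    (sbar := norm0 xbar)
    (hb : b = A *m xbar + z)
    (hgamma_inc : 1 < gamma_inc) (hgamma_dec : 1 <= gamma_dec)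
    (hlambda_tgt : 0 < lambda_tgt)
    (hgamma : 0 < gamma) (hdelta' : 0 < delta' < 1)
    (hgamma_delta' : (1 + delta') / (1 - delta') < gamma)
    (hnoise : Num.max 4 ((gamma + 1) / ((1 - delta') * gamma - (1 + delta')))
                * `|A^T *m z| <= lambda_tgt)
    (hrho : 0 < rho_minus A (sbar + 2 * st))
    (hst : 16 * (gamma_inc * rho_plus A (sbar + 2 * st) + 2 * rho_plus A st)
             / rho_minus A (sbar + st) * (1 + gamma) * sbar%:R < st%:R)
    (hL_min : 0 < L_min <= gamma_inc * rho_plus A (sbar + 2 * st))
    (hlambda0 : lambda_tgt <= lambda0 A b)
    (heps : 0 < eps)
    (hdelta : 0 < delta < 1) (heta : 0 < eta < 1)
    (hdelta_eta : (1 + delta) / (1 + delta') <= eta)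
    (N := num_stages A b eta lambda_tgt)
    (kappa := rho_plus A (sbar + 2 * st) / rho_minus A (sbar + 2 * st))
    (C := 8 * gamma_inc * (1 + kappa) ^+ 2 * (1 + gamma) * kappa * sbar%:R)
    (rate := ln (1 - 1 / (4 * gamma_inc * kappa))^-1) :
  (exists t, homotopy_run A b lambda_tgt eps L_min gamma_inc gamma_dec
               eta delta t)
  /\
  forall t, homotopy_run A b lambda_tgt eps L_min gamma_inc gamma_dec
              eta delta t ->
  [/\
   [/\ forall K : nat, (K < N)%N ->
         (norm0 (restr (~: supp xbar) (hx t K)) <= st)%N
         /\ omega A b (lambda_ A b eta K.+1) (hx t K)
              <= delta' * lambda_ A b eta K.+1,
       (norm0 (restr (~: supp xbar) (hx t N)) <= st)%N
         /\ omega A b lambda_tgt (hx t N) <= delta' * lambda_tgt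
     & forall K : nat, (K < N)%N ->
         (hsteps t K)%:R <= ln (C / delta ^+ 2) / rate],
   forall K : nat, (K < N)%N ->
     phi A b lambda_tgt (hx t K) - phi_star A b lambda_tgt
       <= eta ^+ (2 * K.+1)
            * ((9 / 2) * (1 + gamma) * lambda0 A b ^+ 2 * sbar%:R
                 / rho_minus A (sbar + st))
     /\ norm2 (hx t K - xbar)
       <= eta ^+ K.+1
            * (2 * lambda0 A b * Num.sqrt sbar%:R / rho_minus A (sbar + st))
   & (total_steps t N)%:R
       <= Num.max 1
            ((ln (lambda0 A b / lambda_tgt) / ln eta^-1 * ln (C / delta ^+ 2)
              + ln (Num.max 1 (lambda_tgt ^+ 2 * C / eps ^+ 2))) / rate)
     /\ phi A b lambda_tgt (hx_tgt t) - phi_star A b lambda_tgt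
       <= 4 * (1 + gamma) * lambda_tgt * sbar%:R / rho_minus A (sbar + st)
            * eps].
Proof.
split.
  by apply: (@homotopy_terminates R m n A b z xbar st gamma delta').
move=> t run.
have states K : (K <= N)%N ->
    stage_state A b xbar st gamma_inc delta eta K (hx t K) (hM t K).
  by apply: (@run_state R m n A b z xbar st gamma delta' lambda_tgt gamma_inc
    gamma_dec L_min eps).
split; first split.
- move=> K KN; rewrite norm0_off.
  have : warm_start A b xbar st delta' (lambda_ A b eta K.+1) (hx t K).
    exact: (stage_warm_next hlambda_tgt hdelta' hlambda0 heta hdelta_eta KN
      (states K (ltnW KN))).
  by [].
- rewrite norm0_off.
  have : warm_start A b xbar st delta' lambda_tgt (hx t N).
    exact: (stage_warm_tgt hlambda_tgt hdelta' hlambda0 heta hdelta_eta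
      (states N (leqnn N))).
  by [].
- move=> K KN; apply: (@le_trans _ _ (hsteps t K).+1%:R).
    by rewrite ler_nat.
  by apply: (@run_stage_steps R m n A b z xbar st gamma delta' lambda_tgt
    gamma_inc gamma_dec L_min eps delta eta).
- move=> K KN; have sK := states K (ltnW KN); split.
    by apply: (@stage_gap_le R m n A b z xbar st gamma delta' lambda_tgt
      gamma_inc delta eta hb _ _ _ _ _ _ _ _ _ _ _ K _ (hM t K)).
  by apply: (@stage_error_le R m n A b z xbar st gamma delta' lambda_tgt
    gamma_inc delta eta hb _ _ _ _ _ _ _ _ _ K _ (hM t K)).
split.
  by apply: (@run_total_steps R m n A b z xbar st gamma delta' lambda_tgt
    gamma_inc gamma_dec L_min eps delta eta).
exact: (final_gap_bound hb hgamma_inc hgamma_dec hlambda_tgt hgamma hdelta'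
  hgamma_delta' hnoise hrho hst hL_min hlambda0 heps heta hdelta_eta
  (states N (leqnn N)) (hrun_final run)).
Qed.
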